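(* Let $n\geq 4$. If $n\equiv 0\ (\mathrm{mod}\ 4)$ [respectively, $n\equiv 1\ (\mathrm{mod}\ 4)$, $n\equiv 2\ (\mathrm{mod}\ 4)$, $n\equiv 3\ (\mathrm{mod}\ 4)$], then $\{g^2,h,g_n\}$ [respectively, $\{g,h,g_n^2\}$, $\{g^2,hg,g_1,g_n\}$, $\{g,g_n^2,h_ng_n\}$] is a generating set of the monoid $\mathcal{AOR}_n$ with minimum size. In particular, $\mathcal{AOR}_n$ has rank $4$ if $n\equiv 2\ (\mathrm{mod}\ 4)$, and $\mathcal{AOR}_n$ has rank $3$ if $n\not\equiv 2\ (\mathrm{mod}\ 4)$.
   Context: Let $\Omega_n=\{1<2<\cdots<n\}$ and let $\mathcal{I}_n$ be the symmetric inverse monoid on $\Omega_n$ (all injective partial maps of $\Omega_n$), with maps written on the right and composed left to right: $x(\alpha\beta)=(x\alpha)\beta$. The alternating inverse monoid is $\mathcal{AI}_n=\{\alpha\in\mathcal{I}_n : \alpha=\sigma|_{\mathrm{Dom}(\alpha)}\text{ for some even permutation }\sigma\text{ of }\Omega_n\}$. A partial permutation $\alpha$ with $\mathrm{Dom}(\alpha)=\{a_1<\cdots<a_t\}$, $t\geq 0$, is orientation-preserving [respectively, orientation-reversing] if there is at most one index $i\in\{1,\ldots,t\}$ with $a_i\alpha>a_{i+1}\alpha$ [respectively, $a_i\alpha<a_{i+1}\alpha$], where $a_{t+1}$ denotes $a_1$; it is oriented if it is orientation-preserving or orientation-reversing. $\mathcal{AOR}_n$ is the submonoid of all oriented elements of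 $\mathcal{AI}_n$. Let $g=(1\,2\,\cdots\,n)$ be the $n$-cycle $1\mapsto2\mapsto\cdots\mapsto n\mapsto1$, and let $h$ be the permutation $x\mapsto n+1-x$ of $\Omega_n$. Let $g_n$ be the partial permutation with domain and image $\{1,\ldots,n-1\}$ given by $1\mapsto2\mapsto\cdots\mapsto n-1\mapsto1$; let $h_n$ be the partial permutation with domain and image $\{1,\ldots,n-1\}$ given by $x\mapsto n-x$; let $g_1$ be the partial permutation with domain and image $\{2,\ldots,n\}$ given by $2\mapsto3\mapsto\cdots\mapsto n\mapsto2$. The rank of a finite monoid is the minimum size of a generating set (as a monoid). *)

(* Defs.v *)
From HB Require Import structures.
From mathcomp Require Import all_boot all_fingroup.

Set Implicit Arguments.
Unset Strict Implicit.
Unset Printing Implicit Defensive.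

Local Open Scope group_scope.

(* The chain {1 < ... < n} is represented by 'I_n, with x in {1, ..., n}
   corresponding to the ordinal of value x - 1; a partial map sends the points
   outside its domain to None. *)
Definition pdom n (f : 'I_n -> option 'I_n) : {set 'I_n} := [set x | isSome (f x)].

Definition pinj n (f : 'I_n -> option 'I_n) : bool := dinjectiveb f (pdom f).

(* The symmetric inverse monoid. *)
Record pperm (n : nat) := PPerm {
  pfun :> {ffun 'I_n -> option 'I_n};
  pfun_inj : pinj pfun }.

HB.instance Definition _ n := [isSub for @pfun n].
HB.instance Definition _ n := [Countable of pperm n by <:].
HB.instance Definition _ n := [Finite of pperm n by <:].

Section PPermMonoid.
Variable n : nat.
Implicit Types (f : 'I_n -> option 'I_n) (a b c : pperm n).

Lemma pinjP f :
  reflect (forall x y z, f x = Some z -> f y = Some z -> x = y) (pinj f).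
Proof.
apply: (iffP (dinjectiveP _ _)) => [inj x y z fx fy | inj x y].
  by apply: inj; rewrite ?inE ?fx ?fy.
by rewrite !inE; case fx: (f x) => [z|] // _ _ fy; apply: inj fx (esym fy).
Qed.

Lemma ppermP a b : a =1 b -> a = b.
Proof. by move=> eq_ab; apply/val_inj/ffunP. Qed.

Fact finfun_pinj f : pinj f -> pinj (finfun f).
Proof. by move/pinjP=> fP; apply/pinjP=> x y z; rewrite !ffunE; apply: fP. Qed.

Definition mkpperm f (injf : pinj f) : pperm n := PPerm (finfun_pinj injf).

Fact pperm_one_subproof : pinj (@Some 'I_n).
Proof. by apply/pinjP=> x y z [->] [->]. Qed.
Definition pperm_one : pperm n := mkpperm pperm_one_subproof.

(* Maps act on the right: x (a b) = (x a) b. *)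
Fact pperm_mul_subproof a b : pinj (fun x => obind b (a x)).
Proof.
apply/pinjP=> x y z; case ax: (a x) => [u|] //=; case ay: (a y) => [v|] //= bu bv.
have /pinjP injb := pfun_inj b; have /pinjP inja := pfun_inj a.
by rewrite (injb _ _ _ bu bv) in ax; apply: inja ax ay.
Qed.
Definition pperm_mul a b : pperm n := mkpperm (pperm_mul_subproof a b).

Lemma pperm_mulA : associative pperm_mul.
Proof.
move=> a b c; apply: ppermP => x; rewrite !ffunE.
by case: (a x) => //= u; rewrite ffunE.
Qed.

Lemma pperm_mul1g : left_id pperm_one pperm_mul.
Proof. by move=> a; apply: ppermP => x; rewrite !ffunE. Qed.

Lemma pperm_mulg1 : right_id pperm_one pperm_mul.
Proof.
by move=> a; apply: ppermP => x; rewrite !ffunE; case: (a x) => //= u; rewrite ffunE.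
Qed.

End PPermMonoid.

HB.instance Definition _ n :=
  isMonoid.Build (pperm n) (@pperm_mulA n) (@pperm_mul1g n) (@pperm_mulg1 n).

Section Rank.
Variable n : nat.
Implicit Types A M : {set pperm n}.

Definition generates A M : Prop :=
  [/\ monoid_closed M, A \subset M
    & forall S : {set pperm n}, monoid_closed S -> A \subset S -> M \subset S].

Definition min_generating_set A M : Prop :=
  generates A M /\ forall B : {set pperm n}, generates B M -> #|A| <= #|B|.

Definition has_rank M (r : nat) : Prop :=
  exists2 A : {set pperm n}, min_generating_set A M & #|A| = r.

End Rank.

(* The sequence (a_1 alpha, ..., a_t alpha), where Dom(alpha) = {a_1 < ... < a_t}. *)
Definition images n (a : pperm n) : seq nat := map val (pmap a (enum (pdom a))).

(* ordS is the cyclic successor on indices: the last one is followed by 0. *)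
Definition orientation_preserving n (a : pperm n) : bool :=
  let s := images a in
  #|[set i : 'I_(size s) | nth 0 s i > nth 0 s (ordS i)]| <= 1.

Definition orientation_reversing n (a : pperm n) : bool :=
  let s := images a in
  #|[set i : 'I_(size s) | nth 0 s i < nth 0 s (ordS i)]| <= 1.

Definition oriented n (a : pperm n) : bool :=
  orientation_preserving a || orientation_reversing a.

Definition AI n : {set pperm n} :=
  [set a : pperm n | [exists s : 'S_n,
    ~~ odd_perm s && [forall x in pdom a, a x == Some (s x)]]].

Definition AOR n : {set pperm n} := [set a in AI n | oriented a].

(* The partial map of 'I_n with domain {x | P x} sending x to F x. *)
Definition partial_map n (P : pred nat) (F : nat -> nat) (x : 'I_n) : option 'I_n :=
  if P x then insub (F x) else None.

Fact partial_map_inj n (P : pred nat) (F : nat -> nat) :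
  (forall x y, x < n -> y < n -> P x -> P y -> F x = F y -> x = y) ->
  pinj (@partial_map n P F).
Proof.
move=> inj; apply/pinjP=> x y z; rewrite /partial_map.
case: ifP => // Px; case: ifP => // Py.
case: insubP => // u _ uE [<-]; case: insubP => // v _ vE [vu].
have eqF : F x = F y by rewrite -uE -vE vu.
exact/val_inj/(inj _ _ (ltn_ord x) (ltn_ord y) Px Py eqF).
Qed.

Section Generators.
Variable n : nat.

Let cyc_inj m x y : x < m -> y < m -> x.+1 %% m = y.+1 %% m -> x = y.
Proof.
move=> xm ym /eqP; rewrite -(addn1 x) -(addn1 y) eqn_modDr => /eqP.
by rewrite !modn_small.
Qed.

Fact pg_subproof : pinj (@partial_map n predT (fun x => x.+1 %% n)).
Proof. by apply: partial_map_inj => x y xn yn _ _; apply: cyc_inj. Qed.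
Definition pg : pperm n := mkpperm pg_subproof.

Fact ph_subproof : pinj (@partial_map n predT (fun x => n.-1 - x)).
Proof.
apply: partial_map_inj => x y xn yn _ _ eq_xy.
have le_pred z : z < n -> z <= n.-1 by move=> zn; rewrite -ltnS (ltn_predK zn).
by rewrite -(subKn (le_pred _ xn)) eq_xy subKn // le_pred.
Qed.
Definition ph : pperm n := mkpperm ph_subproof.

Fact pgn_subproof :
  pinj (@partial_map n (fun x => x < n.-1) (fun x => x.+1 %% n.-1)).
Proof. by apply: partial_map_inj => x y _ _; apply: cyc_inj. Qed.
Definition pgn : pperm n := mkpperm pgn_subproof.

Fact phn_subproof :
  pinj (@partial_map n (fun x => x < n.-1) (fun x => n.-2 - x)).
Proof.
apply: partial_map_inj => x y _ _ xn yn eq_xy.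
have le_pred z : z < n.-1 -> z <= n.-2.
  by move=> zn; rewrite -ltnS (ltn_predK zn).
by rewrite -(subKn (le_pred _ xn)) eq_xy subKn // le_pred.
Qed.
Definition phn : pperm n := mkpperm phn_subproof.

Fact pg1_subproof :
  pinj (@partial_map n (fun x => 0 < x) (fun x => if x == n.-1 then 1%N else x.+1)).
Proof.
apply: partial_map_inj => x y _ _ x0 y0.
case: eqP => [->|_]; case: eqP => [->|_] //.
- by case=> y_eq0; rewrite -y_eq0 in y0.
- by case=> x_eq0; rewrite x_eq0 in x0.
- by case.
Qed.
Definition pg1 : pperm n := mkpperm pg1_subproof.

End Generators.

(* Main.v *)
(** A partial permutation is orientation-preserving iff it preserves cyclically
    ordered triples of points of its domain, so the oriented elements are closed
    under composition, and every element of [AOR n] is a restriction [pid A * pp s]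
    of an even permutation [s].

    Orientation-preserving elements of rank at least [n - 1] are [g^k] or
    [g^a g_n^k g^b], and evenness constrains the exponents.  In rank at most
    [n - 2] parity is no constraint.  Indeed a point can jump into an adjacent hole:
    if there is a second hole nearby, this odd move is a restriction of a 3-cycle,
    and a remote second hole is first moved by 3-cycles, two steps at a time.
    Order-preserving maps are products of such moves; [g] restricted to
    [1, ..., n-1] is order-preserving, so by conjugation every restriction of
    [g] of rank at most [n - 2] is generated too, and with it every
    orientation-preserving map of that rank.
    Orientation-reversing elements are reached by multiplying by a reversing
    involution.

    For the lower bounds, a nonunit never helps to generate units, and the units
    are a noncyclic dihedral group unless [n = 3 mod 4].  If [n = 2 mod 4] the units
    preserve the parity of points, so the nonunit generators must miss points of
    both parities.  If [n = 3 mod 4] the units are the rotations; a single nonunit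
    generator of rank [n - 1] would be a reversing involution up to rotations, which
    cannot produce [g_n^2]. *)
Require Import Defs.
From mathcomp Require Import all_boot all_fingroup zify.

Set Implicit Arguments.
Unset Strict Implicit.
Unset Printing Implicit Defensive.

Local Open Scope group_scope.

(** * Orientation in terms of cyclically ordered triples *)

Definition cyc (x y z : nat) := [|| x < y < z, y < z < x | z < x < y].

Lemma cyc_rot x y z : cyc x y z = cyc y z x.
Proof. by rewrite /cyc orbC -orbA. Qed.

Lemma descent_between (F : nat -> nat) i j :
  i <= j -> F j < F i -> exists2 k, i <= k < j & F k.+1 < F k.
Proof.
elim: j => [|j IHj] lij Fji.
  by move: lij; rewrite leqn0 => /eqP i0; rewrite i0 ltnn in Fji.
have [ltFj | leFj] := ltnP (F j.+1) (F j).
  have [eq_i | ne_i] := eqVneq i j.+1; first by subst i; lia.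
  by exists j; lia.
have lij' : i <= j by have [eq_i | ne_i] := eqVneq i j.+1; [subst i; lia | lia].
have [k ltk Fk] := IHj lij' (leq_ltn_trans leFj Fji).
by exists k => //; lia.
Qed.

(** For distinct values, indices [i < j < k] give a noncyclic triple exactly when two of the three
    passages [i] to [j], [j] to [k] and [k] round to [i] go down. A falling passage contains a
    descent of its own, and the three arcs are disjoint. *)
Lemma cyclic_descents t (F : nat -> nat) :
    (forall i j, i < t -> j < t -> F i = F j -> i = j) ->
  (#|[set i : 'I_t | F i > F (ordS i)]| <= 1) <->
  (forall i j k, i < j < k -> k < t -> cyc (F i) (F j) (F k)).
Proof.
move=> injF; split=> [/card_le1_eqP desc1 i j k ltijk ltk | cycF].
  have desc u v : u < t -> v < t -> F (u.+1 %% t) < F u ->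
      F (v.+1 %% t) < F v -> u = v.
    move=> ltu ltv du dv; have := desc1 (Ordinal ltu) (Ordinal ltv).
    by rewrite !inE /= du dv => /(_ isT isT) [].
  have step u v : u <= v -> v < t -> F v < F u ->
      exists2 w, u <= w < v & F (w.+1 %% t) < F w.
    move=> leuv ltv /(descent_between leuv)[w ltw Fw]; exists w => //.
    by rewrite modn_small //; lia.
  (* The passage from [k] round to [i] goes down before [i], after [k], or at the step from [t.-1]
     to [0]. *)
  have wrap : F i < F k -> exists2 w, w < i \/ k <= w < t & F (w.+1 %% t) < F w.
    move=> Fik; have t_gt0 : 0 < t by lia.
    have [lt0i | le_i0] := ltnP (F i) (F 0).
      have [||//|w ltw Fw] := @step 0 i _ _ _; [lia | lia|].
      by exists w => //; left; lia.
    have [ltl | lel] := ltnP (F t.-1) (F k).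
      have [||//|w ltw Fw] := @step k t.-1 _ _ _; [lia | lia|].
      by exists w => //; right; lia.
    exists t.-1; first by right; lia.
    by rewrite prednK // modnn; lia.
  have nij : F i <> F j by move/injF; lia.
  have njk : F j <> F k by move/injF; lia.
  have nik : F i <> F k by move/injF; lia.
  rewrite /cyc; apply: contraT => ncyc.
  have [ltji | ltij] := ltnP (F j) (F i).
    have [||//|w ltw Fw] := @step i j _ _ _; [lia | lia|].
    have [ltkj | ltjk] := ltnP (F k) (F j).
      have [||//|w' ltw' Fw'] := @step j k _ _ _; [lia | lia|].
      by have := desc w w' _ _ Fw Fw'; lia.
    have [|w' ltw' Fw'] := wrap; first by lia.
    by have := desc w w' _ _ Fw Fw'; lia.
  have [|||w ltw Fw] := @step j k _ _ _; [lia | lia| lia|].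
  have [|w' ltw' Fw'] := wrap; first by lia.
  by have := desc w w' _ _ Fw Fw'; lia.
(* Conversely, two descents at [u < v] produce a noncyclic triple among [u], [u.+1], [v] and [v.+1];
   when [v] is the last index, its successor is [0]. *)
apply/card_le1_eqP => u v; rewrite !inE => du dv; apply/val_inj.
wlog ltuv : u v du dv / u < v => [IH|].
  have [|/IH -> //|//] := ltngtP u v.
  by move=> ltuv; apply: IH.
have ltv := ltn_ord v; have ltu := ltn_ord u.
move: du dv; rewrite /= (@modn_small u.+1); last by lia.
have [ltv' | lev'] := ltnP v.+1 t.
  rewrite modn_small //; have [<- | ne_u] := eqVneq u.+1 v.
    move=> du dv; have := cycF u u.+1 u.+2; rewrite /cyc; lia.
  have := cycF u u.+1 v; have := cycF u u.+1 v.+1.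
  have := cycF u v v.+1; have := cycF u.+1 v v.+1; rewrite /cyc; lia.
have -> : v.+1 = t :> nat by lia.
rewrite modnn; have [eq_u | ne_u] := eqVneq u.+1 v.
  rewrite -eq_u; have [-> | u_gt0] := posnP u; first by lia.
  have := cycF 0 u u.+1; rewrite /cyc; lia.
have [u0 | u_gt0] := posnP u.
  have := cycF u u.+1 v; rewrite !u0 /cyc; lia.
have := cycF 0 u u.+1; have := cycF 0 u v; have := cycF 0 u.+1 v.
have := cycF u u.+1 v; rewrite /cyc; lia.
Qed.

Definition opres n (a : pperm n) : Prop :=
  forall x y z x' y' z' : 'I_n, a x = Some x' -> a y = Some y' -> a z = Some z' ->
  cyc x y z -> cyc x' y' z'.

Definition orev n (a : pperm n) : Prop :=
  forall x y z x' y' z' : 'I_n, a x = Some x' -> a y = Some y' -> a z = Some z' ->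
  cyc x y z -> cyc z' y' x'.

Lemma pperm_inj n (a : pperm n) x y z : a x = Some z -> a y = Some z -> x = y.
Proof. exact/pinjP/pfun_inj. Qed.

Lemma pmap_odflt (T U : Type) (f : T -> option U) u s :
  all (fun x => isSome (f x)) s -> pmap f s = [seq odflt u (f x) | x <- s].
Proof. by elim: s => //= x s IHs; case: (f x) => //= y /IHs ->. Qed.

Lemma sorted_enum_ord n (A : {set 'I_n}) :
  sorted (fun x y : 'I_n => x < y) (enum A).
Proof.
rewrite {1}/enum_mem -enumT; apply: sorted_filter.
  by move=> y x z /= /ltn_trans; apply.
by have := iota_ltn_sorted 0 n; rewrite -val_enum_ord sorted_map.
Qed.

(** The increasing enumeration of the domain matches triples of indices with triples of points up to
    rotation, so [cyclic_descents] applies. The relabelling [phi] of the values lets one lemma serve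
    both orientations: the identity for preserving, [subn n] for reversing. *)
Lemma oriented_triples n (a : pperm n) (phi : nat -> nat) :
    {in gtn n &, injective phi} ->
  let s := images a in
  (#|[set i : 'I_(size s) | phi (nth 0 s i) > phi (nth 0 s (ordS i))]| <= 1) <->
  (forall x y z x' y' z' : 'I_n, a x = Some x' -> a y = Some y' -> a z = Some z' ->
     cyc x y z -> cyc (phi x') (phi y') (phi z')).
Proof.
(* Without points there is no [ord0] to serve as default, but then the sequence of images is
   empty. *)
case: n a => [|n] a inj_phi s.
  split=> [_ [] // | _]; rewrite leq_eqVlt ltnS leqn0 cards_eq0; apply/orP; right.
  apply/eqP/setP=> -[i]; have -> // : s = [::] by rewrite /s /images; case: pmap => // -[].
pose d := enum (pdom a); pose v x := odflt ord0 (a x).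
have vE x : x \in pdom a -> a x = Some (v x).
  by rewrite inE /v; case: (a x).
have sE : s = [seq val (v x) | x <- d].
  rewrite /s /images (@pmap_odflt _ _ _ ord0) -?map_comp //.
  by apply/allP => x; rewrite mem_enum inE.
have sized : size s = size d by rewrite sE size_map.
have nthE i : i < size s -> nth 0 s i = v (nth ord0 d i).
  by move=> lti; rewrite sE (nth_map ord0) // -sized.
have nthP i : i < size s -> a (nth ord0 d i) = Some (v (nth ord0 d i)).
  by move=> lti; apply: vE; rewrite -(mem_enum (pdom a)) mem_nth // -sized.
have nth_lt i j : i < j -> j < size s -> nth ord0 d i < nth ord0 d j.
  move=> ltij ltj; apply: (sorted_ltn_nth _ ord0 (sorted_enum_ord _)) => //.
  - by move=> y x z /= /ltn_trans; apply.
  - by rewrite inE; move: ltj; rewrite sized; apply: ltn_trans.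
  - by rewrite inE; move: ltj; rewrite sized.
have idx x x' : a x = Some x' ->
    exists2 i, i < size s & x = nth ord0 d i /\ nth 0 s i = x'.
  move=> ax; have xd : x \in d by rewrite mem_enum inE ax.
  have lti : index x d < size s by rewrite sized index_mem.
  by exists (index x d) => //; rewrite nthE // nth_index // /v ax.
have idx_lt i j : i < size s -> j < size s ->
    nth ord0 d i < nth ord0 d j -> i < j.
  move=> lti ltj; rewrite [i < j]ltnNge; apply: contraL.
  rewrite -leqNgt leq_eqVlt => /predU1P[-> // | ltji].
  exact/ltnW/nth_lt.
apply: iff_trans.
  apply: (@cyclic_descents (size s) (fun i => phi (nth 0 s i))) => i j lti ltj.
  rewrite !nthE // => /(inj_phi _ _ (ltn_ord _) (ltn_ord _))/val_inj eqv.
  have := nthP i lti; rewrite eqv => /pperm_inj/(_ (nthP j ltj)) eq_nth.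
  by apply/eqP; rewrite -(nth_uniq ord0 _ _ (enum_uniq (pdom a))) -?sized // eq_nth.
split=> [cycs x y z x' y' z' | cyca i j k /andP[ltij ltjk] ltk].
  move=> /idx[i lti [-> <-]] /idx[j ltj [-> <-]] /idx[k ltk [-> <-]].
  have rot p q r : p < size s -> q < size s -> r < size s ->
      nth ord0 d p < nth ord0 d q < nth ord0 d r ->
      cyc (phi (nth 0 s p)) (phi (nth 0 s q)) (phi (nth 0 s r)).
    move=> ltp ltq ltr /andP[pq qr]; apply: cycs => //.
    by rewrite (idx_lt p q) ?(idx_lt q r).
  case/or3P => /rot rot_ijk.
  - exact: rot_ijk.
  - by rewrite cyc_rot; apply: rot_ijk.
  - by rewrite -cyc_rot; apply: rot_ijk.
have ltj : j < size s by exact: ltn_trans ltk.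
have lti : i < size s by exact: ltn_trans ltj.
rewrite !nthE //; apply: cyca (nthP _ _) (nthP _ _) (nthP _ _) _ => //.
by rewrite /cyc (nth_lt i j) ?(nth_lt j k).
Qed.

Lemma orientation_preservingP n (a : pperm n) :
  reflect (opres a) (orientation_preserving a).
Proof. by apply: (equivP idP); apply: (@oriented_triples n a id) => x y. Qed.

Lemma orientation_reversingP n (a : pperm n) :
  reflect (orev a) (orientation_reversing a).
Proof.
have lt_images i : nth 0 (images a) i < n \/ size (images a) <= i.
  have [lti|] := ltnP i (size (images a)); last by right.
  by left; have /mapP[y _ ->] := mem_nth 0 lti; apply: ltn_ord.
(* Replacing each value [x] by [n - x] turns ascents into descents and reverses cyclic triples. *)
have [inj_phi phiE] : {in gtn n &, injective (subn n)} /\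
    forall x y z, x < n -> y < n -> z < n ->
    cyc (n - x) (n - y) (n - z) = cyc z y x.
  by split=> [x y|x y z]; rewrite ?inE /cyc; lia.
have := oriented_triples a inj_phi => /= triples.
apply: (equivP idP); rewrite /orientation_reversing.
rewrite (_ : [set i | _] = [set i : 'I_(size (images a)) |
  n - nth 0 (images a) (ordS i) < n - nth 0 (images a) i]); last first.
  apply/setP=> i; rewrite !inE.
  have := lt_images i; have := lt_images (ordS i); have := ltn_ord i.
  have := ltn_ord (ordS i); lia.
apply: iff_trans triples _; split=> rev_a x y z x' y' z' ax ay az cyc_xyz.
  by rewrite -phiE //; apply: rev_a cyc_xyz.
by rewrite phiE //; apply: rev_a cyc_xyz.
Qed.

(** * Restrictions of permutations *)

Section PPermAlgebra.
Variable n : nat.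
Implicit Types (a b c : pperm n) (s t u : 'S_n) (A B : {set 'I_n}) (x y : 'I_n).

Fact pp_subproof s : pinj (fun x : 'I_n => Some (s x)).
Proof. by apply/pinjP=> x y z [<-] [/perm_inj]. Qed.
Definition pp s : pperm n := mkpperm (pp_subproof s).

Fact pid_subproof A : pinj (fun x : 'I_n => if x \in A then Some x else None).
Proof. by apply/pinjP=> x y z; case: ifP => // _ [<-]; case: ifP => // _ []. Qed.
Definition pid A : pperm n := mkpperm (pid_subproof A).

Lemma ppE s x : pp s x = Some (s x). Proof. by rewrite ffunE. Qed.
Lemma pidE A x : pid A x = if x \in A then Some x else None.
Proof. by rewrite ffunE. Qed.
Lemma mulpE a b x : (a * b) x = obind b (a x). Proof. by rewrite ffunE. Qed.
(* Steps through a composition where [/=] would unfold the second factor. *)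
Lemma obind_Some (f : 'I_n -> option 'I_n) x : obind f (Some x) = f x.
Proof. by []. Qed.
Lemma onepE x : (1 : pperm n) x = Some x. Proof. by rewrite ffunE. Qed.
Lemma pid_ppE A s x : (pid A * pp s) x = if x \in A then Some (s x) else None.
Proof. by rewrite mulpE pidE; case: ifP => //= _; rewrite ppE. Qed.

Lemma pp1 : pp 1 = 1.
Proof. by apply/ppermP => x; rewrite ppE onepE perm1. Qed.
Lemma ppM s t : pp (s * t) = pp s * pp t.
Proof. by apply/ppermP => x; rewrite mulpE !ppE /= ppE permM. Qed.
Lemma ppX s k : pp (s ^+ k) = pp s ^+ k.
Proof. by elim: k => [|k IHk]; rewrite ?pp1 // !expgS ppM IHk. Qed.

Lemma pidT : pid setT = 1.
Proof. by apply/ppermP => x; rewrite pidE onepE inE. Qed.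
Lemma pidI A B : pid A * pid B = pid (A :&: B).
Proof.
apply/ppermP => x; rewrite mulpE !pidE inE.
by case: (x \in A); rewrite //= pidE.
Qed.
Lemma pp_pid s A : pp s * pid A = pid (s @^-1: A) * pp s.
Proof. by apply/ppermP => x; rewrite pid_ppE mulpE ppE /= pidE inE. Qed.
Lemma pid_ppM A s B t :
  (pid A * pp s) * (pid B * pp t) = pid (A :&: s @^-1: B) * pp (s * t).
Proof. by rewrite ppM -!mulgA (mulgA (pp s)) pp_pid -pidI !mulgA. Qed.

Lemma pdomP a x : reflect (exists y, a x = Some y) (x \in pdom a).
Proof. by rewrite inE; case: (a x) => [y|]; constructor; [exists y | case]. Qed.
Lemma pid_pdom a : pid (pdom a) * a = a.
Proof.
by apply/ppermP => x; rewrite mulpE pidE inE; case ax: (a x) => [y|] //=.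
Qed.
Lemma pdom_pid_pp A s : pdom (pid A * pp s) = A.
Proof. by apply/setP => x; rewrite inE pid_ppE; case: ifP. Qed.
Lemma pdom_pp s : pdom (pp s) = setT.
Proof. by rewrite -[pp s]mul1g -pidT pdom_pid_pp. Qed.
Lemma pdom_mul a b : pdom (a * b) \subset pdom a.
Proof. by apply/subsetP => x; rewrite !inE mulpE; case: (a x). Qed.
Lemma pid_pp_eq A s t : {in A, s =1 t} -> pid A * pp s = pid A * pp t.
Proof. by move=> eq_st; apply/ppermP => x; rewrite !pid_ppE; case: ifP => // /eq_st->. Qed.

Lemma AIP a : reflect (exists2 s, ~~ odd_perm s & a = pid (pdom a) * pp s) (a \in AI n).
Proof.
rewrite inE; apply: (iffP existsP) => [[s /andP[ev /forall_inP ext]] | [s ev aE]].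
  exists s => //; apply/ppermP => x; rewrite pid_ppE.
  by case: ifP => [/ext/eqP // | ]; rewrite inE; case: (a x).
exists s; rewrite ev; apply/forall_inP => x xa.
by rewrite {1}aE pid_ppE xa.
Qed.

Lemma opres_pid A : opres (pid A).
Proof.
move=> x y z x' y' z'; rewrite !pidE.
by do 3![case: ifP => // _]; move=> [->] [->] [->].
Qed.
Lemma opres1 : opres (1 : pperm n). Proof. by rewrite -pidT; apply: opres_pid. Qed.

Lemma mulp_Some a b x z : (a * b) x = Some z -> exists2 y, a x = Some y & b y = Some z.
Proof. by rewrite mulpE; case: (a x) => //= y; exists y. Qed.

Lemma opresM a b : opres a -> opres b -> opres (a * b).
Proof.
move=> opa opb x y z x' y' z' /mulp_Some[u au bu] /mulp_Some[v av bv].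
by move=> /mulp_Some[w aw bw] /(opa _ _ _ _ _ _ au av aw); apply: opb.
Qed.
Lemma opres_orevM a b : opres a -> orev b -> orev (a * b).
Proof.
move=> opa opb x y z x' y' z' /mulp_Some[u au bu] /mulp_Some[v av bv].
by move=> /mulp_Some[w aw bw] /(opa _ _ _ _ _ _ au av aw); apply: opb.
Qed.
Lemma orev_opresM a b : orev a -> opres b -> orev (a * b).
Proof.
move=> opa opb x y z x' y' z' /mulp_Some[u au bu] /mulp_Some[v av bv].
by move=> /mulp_Some[w aw bw] /(opa _ _ _ _ _ _ au av aw); apply: opb.
Qed.
Lemma orevM a b : orev a -> orev b -> opres (a * b).
Proof.
move=> opa opb x y z x' y' z' /mulp_Some[u au bu] /mulp_Some[v av bv].
by move=> /mulp_Some[w aw bw] /(opa _ _ _ _ _ _ au av aw); apply: opb.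
Qed.

Lemma opresX a k : opres a -> opres (a ^+ k).
Proof.
move=> opa; elim: k => [|k IHk]; first exact: opres1.
by rewrite expgS; apply: opresM.
Qed.

Lemma AORP a : reflect (a \in AI n /\ (opres a \/ orev a)) (a \in AOR n).
Proof.
rewrite /AOR /oriented; apply: (iffP setIdP) => -[aAI ora]; split=> //.
  by case/orP: ora => [/orientation_preservingP | /orientation_reversingP]; [left | right].
apply/orP; case: ora => ora; [left | right].
  exact/orientation_preservingP.
exact/orientation_reversingP.
Qed.

Lemma AOR_op A s : ~~ odd_perm s -> opres (pid A * pp s) -> pid A * pp s \in AOR n.
Proof.
move=> ev op; apply/AORP; split; last by left.
by apply/AIP; exists s => //; rewrite pdom_pid_pp.
Qed.
Lemma AOR_rev A s : ~~ odd_perm s -> orev (pid A * pp s) -> pid A * pp s \in AOR n.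
Proof.
move=> ev op; apply/AORP; split; last by right.
by apply/AIP; exists s => //; rewrite pdom_pid_pp.
Qed.

Lemma AOR_closed : monoid_closed (AOR n).
Proof.
split=> [|a b /AORP[/AIP[s evs aE] ora] /AORP[/AIP[t evt bE] orb]].
  have -> : (1 : pperm n) = pid setT * pp 1 by rewrite pidT pp1 mul1g.
  by apply: AOR_op; rewrite ?odd_perm1 // pidT pp1 mul1g; apply: opres1.
apply/AORP; split.
  apply/AIP; exists (s * t); first by rewrite odd_permM (negPf evs).
  by rewrite aE bE pid_ppM pdom_pid_pp.
case: ora => ora; case: orb => orb; [left|right|right|left].
- exact: opresM.
- exact: opres_orevM.
- exact: orev_opresM.
- exact: orevM.
Qed.

Lemma AOR_mul a b : a \in AOR n -> b \in AOR n -> a * b \in AOR n.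
Proof. by case: AOR_closed => _; apply. Qed.

End PPermAlgebra.

(** * Rotations and reflections *)

Lemma val_lift_max n (x : 'I_n) : lift ord_max x = x :> nat.
Proof. exact: lift_max. Qed.

(** The cycle on [n.+1] points is written with [lift_perm] so that [odd_lift_perm] yields its parity
    at once. *)
Definition rotp n : 'S_n.+1 := lift_perm ord_max ord0 1.
Definition refp n : 'S_n.+1 := perm (@rev_ord_inj n.+1).

Lemma rotpE n (x : 'I_n.+1) : rotp n x = x.+1 %% n.+1 :> nat.
Proof.
case: (unliftP ord_max x) => [y|] ->; last by rewrite lift_perm_id modnn.
by rewrite lift_perm_lift perm1 val_lift_max lift0 modn_small // ltnS.
Qed.

Lemma rotpXE n k (x : 'I_n.+1) : (rotp n ^+ k) x = (x + k) %% n.+1 :> nat.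
Proof.
elim: k => [|k IHk]; first by rewrite perm1 addn0 modn_small.
by rewrite expgSr permM rotpE IHk -addn1 modnDml addn1 addnS.
Qed.

Lemma refpE n (x : 'I_n.+1) : refp n x = n - x :> nat.
Proof. by rewrite permE /= subSS. Qed.

Lemma odd_rotp n : odd_perm (rotp n) = odd n.
Proof. by rewrite odd_lift_perm odd_perm1 addbF addbF. Qed.

(** The reflection of [n.+1] points is a product of [n.+1./2] transpositions. The induction instead
    splits off the point [ord0], sent to [ord_max], since the parity of [lift_perm] is known. *)
Lemma odd_refp n : odd_perm (refp n) = odd n.+1./2.
Proof.
elim: n => [|n IHn].
  have -> : refp 0 = 1 by apply/permP => x; apply/ord_inj; rewrite !ord1.
  by rewrite odd_perm1.
have -> : refp n.+1 = lift_perm ord0 ord_max (refp n).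
  apply/permP => x; apply/ord_inj; case: (unliftP ord0 x) => [y|] ->.
    by rewrite lift_perm_lift val_lift_max !refpE lift0 subSS.
  by rewrite lift_perm_id refpE.
by rewrite odd_lift_perm IHn /=; lia.
Qed.

Lemma refpK n : refp n * refp n = 1.
Proof. by apply/permP => x; rewrite permM perm1 !permE rev_ordK. Qed.

Lemma refpV n : (refp n)^-1 = refp n.
Proof. by apply/eqP; rewrite eq_invg_mul refpK. Qed.

Lemma rotpJ n : rotp n ^ refp n = (rotp n)^-1.
Proof.
apply/eqP; rewrite eq_sym eq_invg_mul; apply/eqP/permP => x; apply/ord_inj.
rewrite perm1 /conjg refpV !permM refpE rotpE refpE rotpE.
have := ltn_ord x; rewrite leq_eqVlt => /predU1P[[->] | ltx].
  by rewrite modnn subn0 modnn subn0.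
by rewrite (@modn_small x.+1) // modn_small; lia.
Qed.

Lemma opres_rotp n : opres (pp (rotp n)).
Proof.
move=> x y z x' y' z'; rewrite !ppE => -[<-] [<-] [<-].
have := ltn_ord x; have := ltn_ord y; have := ltn_ord z.
rewrite /cyc !rotpE; have eqmod w : w < n.+1 ->
    w.+1 %% n.+1 = if w == n then 0 else w.+1.
  move=> ltw; case: eqP => [-> | newn]; first by rewrite modnn.
  by rewrite modn_small //; lia.
move=> ltz lty ltx; rewrite !eqmod //.
by case: (x =P n :> nat); case: (y =P n :> nat); case: (z =P n :> nat); lia.
Qed.

Lemma orev_refp n : orev (pp (refp n)).
Proof.
move=> x y z x' y' z'; rewrite !ppE => -[<-] [<-] [<-].
have := ltn_ord x; have := ltn_ord y; have := ltn_ord z.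
by rewrite /cyc !refpE; lia.
Qed.

Lemma rotp_transitive n (x y : 'I_n.+1) : exists2 r, r \in <[rotp n]> & r x = y.
Proof.
exists (rotp n ^+ (n.+1 - x + y)); first exact: mem_cycle.
apply/ord_inj; rewrite rotpXE addnA subnKC; last exact: ltnW.
by rewrite modnDl modn_small.
Qed.

Lemma opres_cycle_rotp n r : r \in <[rotp n]> -> opres (pp r).
Proof. by case/cycleP => k ->; rewrite ppX; apply/opresX/opres_rotp. Qed.

(** An increasing permutation satisfies [x <= s x], and so does its inverse. *)
Lemma perm_mono_eq1 n (s : 'S_n) : (forall x y : 'I_n, x < y -> s x < s y) -> s = 1.
Proof.
have mono_ge (t : 'S_n) : (forall x y : 'I_n, x < y -> t x < t y) -> forall x : 'I_n, x <= t x.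
  move=> mono_t [x ltx]; elim: x ltx => //= x IHx ltx.
  exact: leq_ltn_trans (IHx (ltnW ltx)) (mono_t (Ordinal (ltnW ltx)) (Ordinal ltx) _).
move=> mono_s; apply/permP => x; rewrite perm1; apply/ord_inj/eqP.
rewrite eqn_leq (mono_ge s) // andbT -{2}[x](permK s) mono_ge // => y z lt_yz.
rewrite ltnNge leq_eqVlt; apply/norP; split.
  by apply/eqP => /ord_inj/perm_inj eq_zy; rewrite eq_zy ltnn in lt_yz.
by apply/negP => /mono_s; rewrite !permKV; lia.
Qed.

(** After a rotation the permutation fixes [0]; cyclic triples that start at [0] then say that it is
    increasing, hence trivial. *)
Lemma perm_opres n (s : 'S_n.+1) : opres (pp s) -> s \in <[rotp n]>.
Proof.
move=> op_s; have [r r_rot rs0] := rotp_transitive (s ord0) ord0.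
suffices sr1 : s * r = 1 by rewrite -[s](mulgK r) sr1 mul1g groupV.
have op_sr : opres (pp (s * r)).
  by rewrite ppM; apply: opresM => //; apply: opres_cycle_rotp.
have sr0 : (s * r) ord0 = ord0 by rewrite permM.
apply: perm_mono_eq1 => x y ltxy; have [x0 | x_gt0] := posnP x.
  have -> : x = ord0 by apply/ord_inj.
  rewrite sr0 lt0n; apply/eqP => sry.
  suffices: y = ord0 by move=> y0; rewrite y0 in ltxy.
  by apply: (@perm_inj _ (s * r)); rewrite sr0; apply/ord_inj.
have := op_sr ord0 x y _ _ _ (ppE _ _) (ppE _ _) (ppE _ _).
by rewrite sr0 /cyc /=; lia.
Qed.

Lemma perm_orev n (s : 'S_n.+1) : orev (pp s) -> refp n * s \in <[rotp n]>.
Proof.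
by move=> orev_s; apply: perm_opres; rewrite ppM; apply: orevM (@orev_refp n) _.
Qed.

(** This is the dihedral relation: conjugation by the reflection inverts every rotation, so [s * s]
    is a rotation times its inverse. *)
Lemma rotp_reflection n (s : 'S_n.+1) : refp n * s \in <[rotp n]> -> s * s = 1.
Proof.
have -> : s * s = (refp n * s) ^ refp n * (refp n * s).
  by rewrite /conjg refpV !mulgA refpK mul1g -(mulgA s) refpK mulg1.
case/cycleP => k ->; rewrite conjXg rotpJ -expgMn; last exact/commute_sym/commuteV/commute_refl.
by rewrite mulVg expg1n.
Qed.

(** * Permutations fixing the last point, and maps missing one point *)

Definition liftp n (s : 'S_n) : 'S_n.+1 := lift_perm ord_max ord_max s.

Lemma liftp_lift n (s : 'S_n) x : liftp s (lift ord_max x) = lift ord_max (s x).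
Proof. exact: lift_perm_lift. Qed.

Lemma liftp_max n (s : 'S_n) : liftp s ord_max = ord_max.
Proof. exact: lift_perm_id. Qed.

Lemma liftpM n (s t : 'S_n) : liftp (s * t) = liftp s * liftp t.
Proof. by rewrite /liftp lift_permM. Qed.

Lemma liftp1 n : liftp 1 = 1 :> 'S_n.+1.
Proof. exact: lift_perm1. Qed.

Lemma liftpX n (s : 'S_n) k : liftp (s ^+ k) = liftp s ^+ k.
Proof. by elim: k => [|k IHk]; rewrite ?liftp1 // !expgS liftpM IHk. Qed.

Lemma odd_liftp n (s : 'S_n) : odd_perm (liftp s) = odd_perm s.
Proof. by rewrite odd_lift_perm addbb. Qed.

Lemma liftp_surj n (s : 'S_n.+1) : s ord_max = ord_max -> exists t : 'S_n, s = liftp t.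
Proof.
move=> s_max.
have unl (x : 'I_n) : exists y, s (lift ord_max x) == lift ord_max y.
  case: (unliftP ord_max (s (lift ord_max x))) => [y -> | ]; first by exists y.
  by rewrite -{2}s_max => /perm_inj/eqP; rewrite eq_sym (negPf (neq_lift _ _)).
pose f x := xchoose (unl x).
have fE x : s (lift ord_max x) = lift ord_max (f x) by apply/eqP/(xchooseP (unl x)).
have inj_f : injective f.
  move=> x y eq_f; apply/(@lift_inj _ ord_max)/(@perm_inj _ s).
  by rewrite !fE eq_f.
exists (perm inj_f); apply/permP => x; case: (unliftP ord_max x) => [y|] ->.
  by rewrite fE lift_perm_lift permE.
by rewrite s_max liftp_max.
Qed.

Definition punct n (i : 'I_n) : pperm n := pid [set~ i].

Lemma punctE n (i x : 'I_n) : punct i x = if x != i then Some x else None.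
Proof. by rewrite pidE !inE. Qed.

Lemma punct_ppE n (i x : 'I_n) (s : 'S_n) :
  (punct i * pp s) x = if x != i then Some (s x) else None.
Proof. by rewrite pid_ppE !inE. Qed.

Lemma punct_liftpE n (s : 'S_n) (x : 'I_n) :
  (punct ord_max * pp (liftp s)) (lift ord_max x) = Some (lift ord_max (s x)).
Proof. by rewrite punct_ppE eq_sym neq_lift lift_perm_lift. Qed.

Lemma punct_liftp_Some n (s : 'S_n) x y :
  (punct ord_max * pp (liftp s)) x = Some y ->
  exists2 x', x = lift ord_max x' & y = lift ord_max (s x').
Proof.
case: (unliftP ord_max x) => [x'|] ->; last by rewrite punct_ppE eqxx.
by rewrite punct_liftpE => -[<-]; exists x'.
Qed.

Lemma opres_liftp n (s : 'S_n) : opres (punct ord_max * pp (liftp s)) <-> opres (pp s).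
Proof.
split=> op_s x y z x' y' z'.
  rewrite !ppE => -[<-] [<-] [<-].
  have := op_s _ _ _ _ _ _ (punct_liftpE s x) (punct_liftpE s y) (punct_liftpE s z).
  by rewrite !val_lift_max.
move=> /punct_liftp_Some[u -> ->] /punct_liftp_Some[v -> ->] /punct_liftp_Some[w -> ->].
by rewrite !val_lift_max; apply: op_s; rewrite ppE.
Qed.

Lemma orev_liftp n (s : 'S_n) : orev (punct ord_max * pp (liftp s)) <-> orev (pp s).
Proof.
split=> op_s x y z x' y' z'.
  rewrite !ppE => -[<-] [<-] [<-].
  have := op_s _ _ _ _ _ _ (punct_liftpE s x) (punct_liftpE s y) (punct_liftpE s z).
  by rewrite !val_lift_max.
move=> /punct_liftp_Some[u -> ->] /punct_liftp_Some[v -> ->] /punct_liftp_Some[w -> ->].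
by rewrite !val_lift_max; apply: op_s; rewrite ppE.
Qed.

(** * Elements of small rank *)

(* The notation ['S_n] leaves [reverse_coercion] marks that hide atoms from [lia]. *)
Ltac ord_lia := unfold reverse_coercion in *; lia.

Lemma pid_pp_step n (A B : {set 'I_n}) (s t : 'S_n) : {in A, forall x, s x \in B} ->
  pid A * pp s * (pid B * pp t) = pid A * pp (s * t).
Proof.
move=> sAB; rewrite pid_ppM; congr (_ * _); congr pid.
by apply/setIidPl/subsetP => x xA; rewrite inE sAB.
Qed.

Definition omono n (a : pperm n) : Prop :=
  forall x y x' y' : 'I_n, a x = Some x' -> a y = Some y' -> x < y -> x' < y'.

Lemma omono_opres n (a : pperm n) : omono a -> opres a.
Proof.
move=> mono_a x y z x' y' z' ax ay az; rewrite /cyc => /or3P cyc_xyz; apply/or3P.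
have mxy := mono_a _ _ _ _ ax ay; have myz := mono_a _ _ _ _ ay az.
have mzx := mono_a _ _ _ _ az ax.
case: cyc_xyz => /andP[lt1 lt2]; [constructor 1 | constructor 2 | constructor 3].
- by rewrite mxy ?myz.
- by rewrite myz ?mzx.
- by rewrite mzx ?mxy.
Qed.

Lemma omonoM n (a b : pperm n) : omono a -> omono b -> omono (a * b).
Proof.
move=> ma mb x y x' y' /mulp_Some[u au bu] /mulp_Some[v av bv].
by move=> /(ma _ _ _ _ au av); apply: mb.
Qed.

(** The submonoid generated by the even orientation-preserving maps of rank at least [n] on [n.+1]
    points. Once it is shown to contain all orientation-preserving elements of [AOR n.+1],
    generating sets need only be tested on these large ranks. *)
Inductive even_gen n : pperm n.+1 -> Prop :=
| even_gen_one : even_gen 1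
| even_gen_mul a b : even_gen a -> even_gen b -> even_gen (a * b)
| even_gen_base (A : {set 'I_n.+1}) s :
    n <= #|A| -> ~~ odd_perm s -> opres (pid A * pp s) -> even_gen (pid A * pp s).

Section EvenGen.
Variable n : nat.
Implicit Types (a b : pperm n.+1) (s t u : 'S_n.+1) (A B : {set 'I_n.+1}) (i j : 'I_n.+1).

Lemma card_punct i : #|[set~ i]| = n.
Proof. by rewrite cardsC1 card_ord. Qed.

Lemma even_gen_punct i s :
  ~~ odd_perm s -> opres (punct i * pp s) -> even_gen (punct i * pp s).
Proof. by apply: even_gen_base; rewrite card_punct. Qed.

(** Points are deleted one at a time, each by a partial identity of rank [n]. *)
Lemma even_gen_pid A : even_gen (pid A).
Proof.
move: {2}#|~: A| (leqnn #|~: A|) => m; elim: m => [|m IHm] in A *.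
  rewrite leqn0 cards_eq0 => /eqP A0; rewrite -[A]setCK A0 setC0 pidT.
  exact: even_gen_one.
move=> lt_m; have [A0 | [i iA]] := set_0Vmem (~: A).
  by apply: IHm; rewrite A0 cards0.
have -> : pid A = pid (i |: A) * (punct i * pp 1).
  rewrite pp1 mulg1 pidI; congr pid; apply/setP => x; rewrite !inE.
  by case: eqP => [-> | _]; rewrite ?andbT //=; apply/negbTE; rewrite inE in iA.
apply: even_gen_mul; last first.
  by apply: even_gen_punct; rewrite ?odd_perm1 // pp1 mulg1; apply: opres_pid.
apply: IHm; rewrite -ltnS; apply: leq_trans lt_m.
by rewrite setCU setIC -setDE [X in _ < X](cardsD1 i) iA.
Qed.

Definition dihedral u := u \in <[rotp n]> \/ u = refp n.

Lemma opres_conj u a : dihedral u -> opres a -> opres (pp u^-1 * a * pp u).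
Proof.
case=> [u_rot | ->] op_a; last first.
  rewrite refpV; apply: orevM; last exact: orev_refp.
  by apply: orev_opresM => //; apply: orev_refp.
by apply: opresM; first apply: opresM => //; apply: opres_cycle_rotp; rewrite ?groupV.
Qed.

Lemma pp_conj u A s :
  pp u^-1 * (pid A * pp s) * pp u = pid (u^-1 @^-1: A) * pp (s ^ u).
Proof. by rewrite /conjg !ppM !mulgA pp_pid. Qed.

Lemma conj_ppM u a b :
  pp u^-1 * (a * b) * pp u = (pp u^-1 * a * pp u) * (pp u^-1 * b * pp u).
Proof. by rewrite !mulgA -(mulgA _ (pp u)) -ppM mulgV pp1 mulg1. Qed.

Lemma conj_ppK u a : pp u^-1 * (pp u * a * pp u^-1) * pp u = a.
Proof. by rewrite !mulgA -ppM mulVg pp1 mul1g -mulgA -ppM mulVg pp1 mulg1. Qed.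

Lemma even_gen_conj u a : dihedral u -> even_gen a -> even_gen (pp u^-1 * a * pp u).
Proof.
move=> dih_u; elim=> [|b c _ IHb _ IHc | A s leA ev op].
- by rewrite mulg1 -ppM mulVg pp1; apply: even_gen_one.
- by rewrite conj_ppM; apply: even_gen_mul.
have := opres_conj dih_u op; rewrite pp_conj => op'.
apply: even_gen_base; rewrite ?odd_permJ //.
by rewrite preim_permV card_imset //; apply: perm_inj.
Qed.

(** The map [a] itself may be odd. Only its restrictions to sets that omit at least two of the
    [n.+1] points are asked for, and there parity is no obstruction. *)
Definition good a := forall A, #|A| < n -> even_gen (pid A * a).

Lemma even_gen_good a : even_gen a -> good a.
Proof. by move=> eg_a A _; apply: even_gen_mul => //; apply: even_gen_pid. Qed.

(** The image [B] of [A] under [a] has no more points than [A], so the second factor may be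
    restricted to [B]. *)
Lemma goodM a b : good a -> good b -> good (a * b).
Proof.
move=> ga gb A ltA; pose B := [set y | [exists x in A, a x == Some y]].
have -> : pid A * (a * b) = (pid A * a) * (pid B * b).
  apply/ppermP => x; rewrite !mulpE pidE; case: ifP => //= xA.
  rewrite ffunE; case ax: (a x) => [y|] //=; rewrite !ffunE.
  suff -> : y \in B by [].
  by rewrite inE; apply/exists_inP; exists x; rewrite ?ax.
apply: even_gen_mul; [exact: ga | apply: gb].
apply: leq_ltn_trans ltA; apply: leq_trans (leq_imset_card (fun x => odflt ord0 (a x)) A).
apply/subset_leq_card/subsetP => y; rewrite inE => /exists_inP[x xA /eqP ax].
by apply/imsetP; exists x; rewrite ?ax.
Qed.

Lemma good_conj u a : dihedral u -> good a -> good (pp u^-1 * a * pp u).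
Proof.
move=> dih_u ga A ltA.
have -> : pid A * (pp u^-1 * a * pp u) = pp u^-1 * (pid (u @^-1: A) * a) * pp u.
  rewrite !mulgA pp_pid; congr (pid _ * _ * _ * _).
  by apply/setP => x; rewrite !inE permKV.
apply: even_gen_conj => //; apply: ga.
by rewrite -[u]invgK preim_permV card_imset //; apply: perm_inj.
Qed.

Lemma punct_conj i s u : pp u^-1 * (punct i * pp s) * pp u = punct (u i) * pp (s ^ u).
Proof.
rewrite pp_conj; congr (pid _ * _); apply/setP => x; rewrite !inE.
by rewrite -(inj_eq (@perm_inj _ u)) permKV.
Qed.

(** The point [j] jumps into the hole [i] and all other points stay. For distinct [i] and [j] the
    only permutation extending this map is a transposition, so the map is not in [AI]; it is shown
    to be [good] for adjacent points. *)
Definition shift i j := punct i * pp (tperm i j).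

Lemma shift_conj u i j : pp u^-1 * shift i j * pp u = shift (u i) (u j).
Proof. by rewrite punct_conj tpermJ. Qed.

Lemma shiftE i j x : shift i j x =
  if x == i then None else if x == j then Some i else Some x.
Proof.
rewrite punct_ppE; case: eqP => //= /eqP nxi; case: tpermP => [/eqP | -> | _ /eqP/negPf->] //.
  by rewrite (negPf nxi).
by rewrite eqxx.
Qed.

Hypothesis n_ge3 : 3 <= n.

Let o k : 'I_n.+1 := inord k.
Let oE k : k <= n -> o k = k :> nat.
Proof. by move=> lek; rewrite inordK. Qed.

Let tperm_spec k l (x : 'I_n.+1) : k <= n -> l <= n -> k <> l ->
  x = k :> nat /\ tperm (o k) (o l) x = l :> nat \/
  x = l :> nat /\ tperm (o k) (o l) x = k :> nat \/
  x <> k :> nat /\ x <> l :> nat /\ tperm (o k) (o l) x = x :> nat.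
Proof.
move=> lek lel nkl; case: tpermP => [-> | -> | nk nl].
- by left; rewrite !oE.
- by right; left; rewrite !oE.
right; right; split; [|split] => // eqx; [apply: nk | apply: nl].
  by apply/ord_inj; rewrite oE.
by apply/ord_inj; rewrite oE.
Qed.

(* The 3-cycle [k -> k+2, k+1 -> k, k+2 -> k+1]: it is increasing off [k]. *)
Let cyc3 k := locked (tperm (o k) (o k.+1) * tperm (o k.+1) (o k.+2)).

Let cyc3_spec k (x : 'I_n.+1) : k.+2 <= n ->
  x = k :> nat /\ cyc3 k x = k.+2 :> nat \/
  x = k.+1 :> nat /\ cyc3 k x = k :> nat \/
  x = k.+2 :> nat /\ cyc3 k x = k.+1 :> nat \/
  x <> k :> nat /\ x <> k.+1 :> nat /\ x <> k.+2 :> nat /\ cyc3 k x = x :> nat.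
Proof.
move=> lek; rewrite /cyc3 -lock permM.
have := @tperm_spec k.+1 k.+2 (tperm (o k) (o k.+1) x) (ltnW lek) lek (@n_Sn _).
case: (@tperm_spec k k.+1 x (ltnW (ltnW lek)) (ltnW lek) (@n_Sn _)) =>
  [[-> ->] | [[-> ->] | [nk [nk1 ->]]]]; lia.
Qed.

Let cyc3V_spec k (x : 'I_n.+1) : k.+2 <= n ->
  x = k.+2 :> nat /\ (cyc3 k)^-1 x = k :> nat \/
  x = k :> nat /\ (cyc3 k)^-1 x = k.+1 :> nat \/
  x = k.+1 :> nat /\ (cyc3 k)^-1 x = k.+2 :> nat \/
  x <> k :> nat /\ x <> k.+1 :> nat /\ x <> k.+2 :> nat /\ (cyc3 k)^-1 x = x :> nat.
Proof.
move=> lek; have := @cyc3_spec k ((cyc3 k)^-1 x) lek; rewrite permKV.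
by case=> [[-> ->] | [[-> ->] | [[-> ->] | [nk [nk1 [nk2 ->]]]]]]; lia.
Qed.

Let odd_cyc3 k : k.+2 <= n -> ~~ odd_perm (cyc3 k).
Proof.
have odd_t l : l < n -> odd_perm (tperm (o l) (o l.+1)).
  move=> ltl; rewrite odd_tperm; apply/eqP => /(congr1 (@nat_of_ord _)).
  by rewrite !oE; lia.
by move=> lek; rewrite /cyc3 -lock odd_permM !odd_t //; apply: ltnW.
Qed.

(** Under [down k] the two points above the hole [k] each move down by one, so the hole goes to
    [k.+2]; [up k] is the inverse move. *)
Let down k := punct (o k) * pp (cyc3 k).
Let up k := punct (o k.+2) * pp (cyc3 k)^-1.

Let even_gen_down k : k.+2 <= n -> even_gen (down k).
Proof.
move=> lek; apply: even_gen_punct (odd_cyc3 lek) _; apply: omono_opres => x y x' y'.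
rewrite !punct_ppE -!val_eqE /= oE; last ord_lia.
have := cyc3_spec x lek; have := cyc3_spec y lek.
by do 2![case: eqP => //= ?]; move=> ? ? [<-] [<-]; ord_lia.
Qed.

Let even_gen_up k : k.+2 <= n -> even_gen (up k).
Proof.
move=> lek; apply: even_gen_punct; first by rewrite odd_permV odd_cyc3.
apply: omono_opres => x y x' y'.
rewrite !punct_ppE -!val_eqE /= oE; last ord_lia.
have := cyc3V_spec x lek; have := cyc3V_spec y lek.
by do 2![case: eqP => //= ?]; move=> ? ? [<-] [<-]; ord_lia.
Qed.

Let holes k := ~: [set o 0; o k].
Let holesP k (x : 'I_n.+1) : k <= n -> reflect (x <> 0 :> nat /\ x <> k :> nat) (x \in holes k).
Proof.
move=> lek; rewrite !inE negb_or -!val_eqE /= !oE //.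
by apply: (iffP andP) => -[/eqP ? /eqP].
Qed.
Let punctP k (x : 'I_n.+1) : k <= n -> reflect (x <> k :> nat) (x \in [set~ o k]).
Proof. by move=> lek; rewrite !inE -val_eqE /= oE //; apply: (iffP idP) => /eqP. Qed.

(* With a second hole at [j], the transposition that fills the hole [0] from
   [1] is adjusted to an even permutation at [j]; for [j >= 4] the hole is
   first brought down to [j - 2]. *)
Let even_gen_holes (j : nat) : 2 <= j <= n -> even_gen (pid (holes j) * pp (tperm (o 0) (o 1))).
Proof.
have [m] := ubnP j; elim: m j => // m IHj j ltjm /andP[j_ge2 lej].
have t01 x := @tperm_spec 0 1 x.
have start : pid (holes j) = pid (holes j) * pp 1 by rewrite pp1 mulg1.
have egp := even_gen_pid (holes j).
have [j2 | j_ne2] := eqVneq j 2.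
  have -> : pid (holes j) * pp (tperm (o 0) (o 1)) = pid (holes j) * down 0.
    rewrite [in RHS]start pid_pp_step => [|x /(holesP _ lej)].
      apply: pid_pp_eq => x /(holesP _ lej) xj; apply/ord_inj; rewrite mul1g.
      by have := t01 x; have := @cyc3_spec 0 x; ord_lia.
    by rewrite perm1 => xj; apply/punctP; ord_lia.
  by apply: even_gen_mul => //; apply: even_gen_down; ord_lia.
have [j3 | j_ne3] := eqVneq j 3.
  (* With holes [0] and [3], the four factors carry [1] through [2, 1, 0, 0] and [2] through
     [3, 3, 3, 2], and fix everything above [3]. *)
  have -> : pid (holes j) * pp (tperm (o 0) (o 1)) =
      pid (holes j) * up 1 * down 0 * down 0 * down 1.
    have E0 x := @cyc3_spec 0 x (ltnW n_ge3); have E1 x := @cyc3_spec 1 x n_ge3.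
    have V1 x := @cyc3V_spec 1 x n_ge3.
    have x_cases (x : 'I_n.+1) : x \in holes j -> x = 1%N :> nat \/ x = 2 :> nat \/ 3 < x.
      by move/(holesP _ lej); lia.
    have e1 (x : 'I_n.+1) : x \in holes j -> let y := (cyc3 1)^-1 x in
        x = 1%N :> nat /\ y = 2 :> nat \/ x = 2 :> nat /\ y = 3 :> nat \/
        3 < x /\ y = x :> nat.
      by have V := V1 x => /x_cases[x1 | [x2 | x4]] /=; ord_lia.
    have e2 (x : 'I_n.+1) : x \in holes j -> let y := cyc3 0 ((cyc3 1)^-1 x) in
        x = 1%N :> nat /\ y = 1%N :> nat \/ x = 2 :> nat /\ y = 3 :> nat \/
        3 < x /\ y = x :> nat.
      by have E := E0 ((cyc3 1)^-1 x) => /e1 /= [[x1 y1] | [[x2 y2] | [x4 y4]]]; ord_lia.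
    have e3 (x : 'I_n.+1) : x \in holes j -> let y := cyc3 0 (cyc3 0 ((cyc3 1)^-1 x)) in
        x = 1%N :> nat /\ y = 0%N :> nat \/ x = 2 :> nat /\ y = 3 :> nat \/
        3 < x /\ y = x :> nat.
      by have E := E0 (cyc3 0 ((cyc3 1)^-1 x)) => /e2 /= [[x1 y1] | [[x2 y2] | [x4 y4]]]; ord_lia.
    rewrite [in RHS]start !pid_pp_step => [|x xj|x xj|x xj|x xj].
    - apply: pid_pp_eq => x xj; apply/ord_inj; rewrite mul1g !permM.
      have T := t01 x; have E := E1 (cyc3 0 (cyc3 0 ((cyc3 1)^-1 x))).
      by case: (e3 x xj) => /= [[x1 y1] | [[x2 y2] | [x4 y4]]]; ord_lia.
    - rewrite mul1g !permM; apply/punctP; first by lia.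
      by case: (e3 x xj) => /= [[x1 y1] | [[x2 y2] | [x4 y4]]]; ord_lia.
    - rewrite mul1g permM; apply/punctP => //.
      by case: (e2 x xj) => /= [[x1 y1] | [[x2 y2] | [x4 y4]]]; ord_lia.
    - rewrite mul1g; apply/punctP => //.
      by case: (e1 x xj) => /= [[x1 y1] | [[x2 y2] | [x4 y4]]]; ord_lia.
    by move/(holesP _ lej): xj => xj; rewrite perm1; apply/punctP; ord_lia.
  do 3!(apply: even_gen_mul; last by apply: even_gen_down; ord_lia).
  by apply: even_gen_mul => //; apply: even_gen_up; ord_lia.
have [k jE] : exists k, j = k.+2 by exists j.-2; ord_lia.
have -> : pid (holes j) * pp (tperm (o 0) (o 1)) =
    pid (holes j) * up k * (pid (holes k) * pp (tperm (o 0) (o 1))) * down k.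
  have lek : k.+2 <= n by rewrite -jE.
  (* Since [k >= 2], the 3-cycle moving the second hole is disjoint from the transposition of [0]
     and [1], so undoing it at the end leaves just that transposition. *)
  have k_ge2 : 2 <= k by lia.
  have e1 (x : 'I_n.+1) : x \in holes j -> let y := (cyc3 k)^-1 x in
      x = k :> nat /\ y = k.+1 :> nat \/ x = k.+1 :> nat /\ y = k.+2 :> nat \/
      [/\ x <> 0 :> nat, x <> k :> nat, x <> k.+1 :> nat, x <> k.+2 :> nat & y = x :> nat].
    move/(holesP _ lej) => /= [x0 xj]; have := @cyc3V_spec k x lek.
    case=> [[xk2 _] | [[-> ->] | [[-> ->] | [nk [nk1 [nk2 ->]]]]]].
    - by case: xj; rewrite xk2 jE.
    - by left.
    - by right; left.
    by right; right; split.
  have e2 (x : 'I_n.+1) : x \in holes j -> let y := tperm (o 0) (o 1) ((cyc3 k)^-1 x) in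
      x = k :> nat /\ y = k.+1 :> nat \/ x = k.+1 :> nat /\ y = k.+2 :> nat \/
      [/\ x <> 0 :> nat, x <> k :> nat, x <> k.+1 :> nat, x <> k.+2 :> nat
        & y = tperm (o 0) (o 1) x :> nat].
    have T := t01 ((cyc3 k)^-1 x) isT => /e1 /= [[x1 y1] | [[x2 y2] | [x0 xk xk1 xk2 y4]]].
    - by left; split=> //; ord_lia.
    - by right; left; split=> //; ord_lia.
    by right; right; split=> //; rewrite (ord_inj y4).
  rewrite [in RHS]start !pid_pp_step => [|x xj|x xj|x xj].
  - apply: pid_pp_eq => x xj; apply/ord_inj; rewrite mul1g !permM.
    have T := t01 x; have := @cyc3_spec k (tperm (o 0) (o 1) ((cyc3 k)^-1 x)) lek.
    by case: (e2 x xj) => /= [[x1 ->] | [[x2 ->] | [x0 xk xk1 xk2 ->]]]; ord_lia.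
  - rewrite mul1g !permM; apply/punctP; first by lia.
    have T := t01 x.
    by case: (e2 x xj) => /= [[x1 ->] | [[x2 ->] | [x0 xk xk1 xk2 ->]]]; ord_lia.
  - rewrite mul1g; apply/holesP; first by lia.
    by case: (e1 x xj) => /= [[x1 ->] | [[x2 ->] | [x0 xk xk1 xk2 ->]]]; ord_lia.
  by move/(holesP _ lej): xj => [x0 xj]; rewrite perm1; apply/punctP; ord_lia.
apply: even_gen_mul; last by apply: even_gen_down; ord_lia.
apply: even_gen_mul; last by apply: IHj; ord_lia.
by apply: even_gen_mul => //; apply: even_gen_up; ord_lia.
Qed.

Lemma good_shift01 : good (shift (inord 0) (inord 1)).
Proof.
move=> A ltA; have -> : pid A * shift (o 0) (o 1) = pid (A :\ o 0) * pp (tperm (o 0) (o 1)).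
  by rewrite mulgA pidI setDE.
have t01 x := @tperm_spec 0 1 x.
have [A1 | nA1] := boolP (o 1 \in A); last first.
  rewrite (@pid_pp_eq _ _ _ 1) => [|x]; first by rewrite pp1 mulg1; apply: even_gen_pid.
  rewrite !inE perm1 => /andP[x0 xA]; case: tpermP => // eqx; first by rewrite eqx eqxx in x0.
  by rewrite -eqx xA in nA1.
(* As [A] has fewer than [n] of the [n.+1] points, there is a hole [j] besides [0]; it is not [1],
   which lies in [A]. *)
have [j] : exists j, j \in ~: A :\ o 0.
  apply/card_gt0P; have := cardsC A; rewrite card_ord (cardsD1 (o 0) (~: A)) => cA.
  rewrite lt0n; apply: contraTneq ltA => c0; rewrite -leqNgt -ltnS.
  move: cA; rewrite c0 addn0 => cA.
  by apply: leq_trans (eq_leq (esym cA)) _; rewrite -(addn1 #|A|) leq_add2l leq_b1.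
rewrite !inE => /andP[j0 jA].
have jo : j = o j by rewrite /o inord_val.
have -> : A :\ o 0 = (A :\ o 0) :&: holes j.
  apply/esym/setIidPl/subsetP => x; rewrite !inE => /andP[x0 xA].
  by rewrite (negPf x0) /= -jo; apply: contraNneq jA => <-.
rewrite -pidI -mulgA; apply: even_gen_mul; first exact: even_gen_pid.
apply: even_gen_holes; apply/andP; split; last by rewrite -ltnS.
have j_ne0 : j <> 0 :> nat by move: j0; rewrite -val_eqE /= oE // => /eqP.
have j_ne1 : j <> 1%N :> nat by move=> j1; rewrite jo j1 A1 in jA.
by lia.
Qed.

End EvenGen.

(** * Orientation-preserving maps missing at least two points *)

Section Good.
Variable n : nat.
Hypothesis n_ge3 : 3 <= n.
Implicit Types (a b : pperm n.+1) (s t u : 'S_n.+1) (A : {set 'I_n.+1}) (i j x y : 'I_n.+1).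

(** Rotations carry the jump from [1] into [0] to any jump from [x.+1] into [x], and the reflection
    reverses its direction. *)
Lemma good_shift i j : i.+1 = j \/ j.+1 = i -> good (shift i j).
Proof.
have up x y : x.+1 = y -> good (shift x y).
  move=> xy; have [r r_rot r0] := rotp_transitive (inord 0 : 'I_n.+1) x.
  have -> : y = r (inord 1).
    case/cycleP: r_rot r0 => k -> /(congr1 (@nat_of_ord _)) r0; apply/ord_inj.
    rewrite rotpXE inordK; last by lia.
    rewrite rotpXE inordK // add0n in r0.
    by rewrite -addnC -modnDml r0 addn1 modn_small xy.
  by rewrite -r0 -shift_conj; apply: good_conj; [left | apply: good_shift01].
case=> [/up // | ji].
rewrite -[i](rev_ordK) -[j](rev_ordK) -!(permE rev_ord_inj) -shift_conj.
apply: good_conj; [by right | apply: up; rewrite !permE /=].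
by have := ltn_ord i; lia.
Qed.

Definition disp a : nat := \sum_x if a x is Some y then (y - x) + (x - y) else 0.

(** Let [x] be the largest point that moves up. Then [x.+1] is outside the domain, for its image
    would lie above that of [x] and it would move up too. Letting [x] first jump to [x.+1] leaves an
    order-preserving map whose total displacement is smaller by one. *)
Lemma good_omono_step a x x' :
    (forall b, disp b < disp a -> omono b -> good b) ->
  omono a -> a x = Some x' -> x < x' -> good a.
Proof.
move=> IH mono_a ax ltx.
pose up z := if a z is Some z' then z < z' else false.
have up_x : up x by rewrite /up ax.
case: (@arg_maxnP _ x up (@nat_of_ord _) up_x) => {}x {ax ltx x'} {}up_x max_x.
move: up_x; rewrite /up; case ax: (a x) => [x'|] // ltx.
have lty : x.+1 < n.+1 by apply: leq_ltn_trans ltx _.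
pose y : 'I_n.+1 := Ordinal lty.
have ay : a y = None.
  case ay: (a y) => [y'|] //; have := mono_a _ _ _ _ ax ay (ltnSn x).
  by have := max_x y; rewrite /up ay /=; lia.
have nxy : (y == x) = false by rewrite -val_eqE /= eqn_leq ltnn.
have nyx : (x == y) = false by rewrite eq_sym.
have -> : a = shift y x * (shift x y * a).
  apply/ppermP => z; rewrite mulpE shiftE.
  case: eqP => [-> // | /eqP nzy]; case: eqP => [-> | /eqP nzx]; rewrite obind_Some mulpE shiftE.
    by rewrite nxy eqxx obind_Some.
  by rewrite (negPf nzy) (negPf nzx) obind_Some.
apply: goodM; first by apply: good_shift; right.
apply: IH; last first.
  apply: omonoM => // u v u' v'; rewrite !shiftE -!val_eqE /=.
  case: eqP => // nux; case: eqP => ux [<-]; case: eqP => // nvx; case: eqP => vx [<-]; lia.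
have bE z : (shift x y * a) z = if z == x then None else if z == y then a x else a z.
  by rewrite mulpE shiftE; case: eqP => // _; case: eqP.
have y_ne : true && (y != x) by rewrite nxy.
rewrite /disp (bigD1 x isT) (bigD1 y y_ne) [X in _ < X](bigD1 x isT).
rewrite [X in _ < _ + X](bigD1 y y_ne) !bE !eqxx nxy ax ay.
rewrite (eq_bigr (fun z => if a z is Some z' then z' - z + (z - z') else 0)); last first.
  by move=> z /andP[/andP[_ nzx] nzy]; rewrite bE (negPf nzx) (negPf nzy).
by rewrite /=; lia.
Qed.

(** Induction on total displacement. If some point moves up, one jump is split off; if some point
    moves down, the same is done after conjugation by the reflection; otherwise the map is a partial
    identity. *)
Lemma good_omono a : omono a -> good a.
Proof.
have [m] := ubnP (disp a); elim: m a => // m IHm a lt_m mono_a.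
(* The hypothesis is stated relative to any [c] with the displacement of [a], since it also serves
   the reflected map. *)
have IH b c : disp c = disp a -> disp b < disp c -> omono b -> good b.
  by move=> -> lt_ba; apply: IHm; apply: leq_trans lt_ba _.
have [/existsP[x] | no_up] := boolP [exists x, if a x is Some y then x < y else false].
  case ax: (a x) => [y|] //; apply: good_omono_step ax => //.
  by move=> b; apply: (IH b a).
have [/existsP[x] | no_down] := boolP [exists x, if a x is Some y then y < x else false].
  case ax: (a x) => [y|] // ltyx.
  pose h := refp n; pose c := pp h * a * pp h.
  have cE z : c (rev_ord z) = omap (@rev_ord n.+1) (a z).
    rewrite /c !mulpE ppE /= permE rev_ordK.
    by case: (a z) => //= w; rewrite ppE permE.
  have revI z : z = rev_ord (rev_ord z) :> 'I_n.+1 by rewrite rev_ordK.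
  have good_c : good c.
    apply: (@good_omono_step c (rev_ord x) (rev_ord y)).
    - move=> b; apply: IH; rewrite /disp (reindex_inj (@rev_ord_inj n.+1)) /=.
      apply: eq_bigr => z _; rewrite cE; case: (a z) => //= w.
      by have := ltn_ord z; have := ltn_ord w; lia.
    - move=> u v u' v'; rewrite (revI u) (revI v) !cE.
      case au: (a _) => [u1|] //= [<-]; case av: (a _) => [v1|] //= [<-].
      have := mono_a _ _ _ _ av au => /=.
      by have := ltn_ord u; have := ltn_ord v; have := ltn_ord u1; have := ltn_ord v1; lia.
    - by rewrite cE ax.
    by rewrite /=; have := ltn_ord x; lia.
  have cV : c = pp h * a * pp h^-1 by rewrite /h refpV.
  by have := @good_conj n h c (or_intror erefl) good_c; rewrite cV conj_ppK.
have -> : a = pid (pdom a).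
  apply/ppermP => x; rewrite pidE inE; case ax: (a x) => [y|] //=; congr Some.
  move/existsPn/(_ x): no_up; move/existsPn/(_ x): no_down; rewrite ax => l1 l2.
  by apply/ord_inj; lia.
exact/even_gen_good/even_gen_pid.
Qed.

(** Off the last point the one-step rotation is order-preserving. A set [A] misses some point [i],
    and conjugation by a rotation, which commutes with the one-step rotation, takes the last point
    to [i]. *)
Lemma good_rotp r : r \in <[rotp n]> -> good (pp r).
Proof.
case/cycleP => k ->; elim: k => [|k IHk].
  by rewrite pp1 -pidT; apply/even_gen_good/even_gen_pid.
rewrite expgSr ppM; apply: goodM => // A ltA.
have [i iA] : exists i, i \notin A.
  apply/existsP; apply: contraTT ltA => /existsPn inA; rewrite -leqNgt.
  rewrite (_ : A = setT) ?cardsT ?card_ord //.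
  by apply/setP => x; rewrite inE; apply/negPn/inA.
have [u u_rot u_max] := rotp_transitive (ord_max : 'I_n.+1) i.
have good_max : good (punct ord_max * pp (rotp n)).
  apply: good_omono => x y x' y'; rewrite !punct_ppE -!val_eqE /=.
  case: eqP => //= nx [<-]; case: eqP => //= ny [<-].
  have eqmod (w : 'I_n.+1) : w <> n :> nat -> w.+1 %% n.+1 = w.+1.
    by move=> nw; rewrite modn_small // ltnS ltn_neqAle -ltnS ltn_ord andbT; apply/eqP.
  by unfold reverse_coercion; rewrite !rotpE !eqmod.
have -> : pid A * pp (rotp n) = pid A * (pp u^-1 * (punct ord_max * pp (rotp n)) * pp u).
  have -> : pp u^-1 * (punct ord_max * pp (rotp n)) * pp u = punct i * pp (rotp n).
    rewrite punct_conj u_max (_ : rotp n ^ u = rotp n) //.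
    apply/conjg_fixP; apply/commgP; case/cycleP: u_rot => l ->.
    exact/commuteX.
  rewrite mulgA pidI (setIidPl _) //; apply/subsetP => x xA; rewrite !inE.
  by apply: contraNneq iA => <-.
exact: (good_conj (or_introl u_rot) good_max).
Qed.

(** Rotating the images so that the least point of the domain goes to [0] makes the map
    order-preserving; the inverse rotation is good as well. *)
Lemma good_opres a : opres a -> good a.
Proof.
move=> op_a; have [a0 | [x xa]] := set_0Vmem (pdom a).
  by rewrite -[a]pid_pdom a0; apply: good_omono => x y x' y'; rewrite mulpE pidE inE.
case: (@arg_minnP _ x (mem (pdom a)) (@nat_of_ord _) xa) => {}x {}xa min_x.
have min_x' y y' : a y = Some y' -> x <= y by move=> ay; apply: min_x; apply/pdomP; exists y'.
have /pdomP[x' ax] := xa.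
have [r r_rot rx'] := rotp_transitive x' ord0.
have -> : a = a * pp r * pp r^-1 by rewrite -mulgA -ppM mulgV pp1 mulg1.
apply: goodM; last by apply: good_rotp; rewrite groupV.
have op_ar : opres (a * pp r) by apply: opresM => //; apply: opres_cycle_rotp.
have arx : (a * pp r) x = Some ord0 by rewrite mulpE ax /= ppE rx'.
apply: good_omono => y z y' z' ary arz ltyz.
have lexy : x <= y by have [v /min_x'] := mulp_Some ary.
have z'_gt0 : 0 < z'.
  rewrite lt0n; apply/eqP => z'0; suff xz : x = z by rewrite xz in lexy; lia.
  by apply: pperm_inj arx _; rewrite arz; congr Some; apply/ord_inj.
have [xy | nxy] := eqVneq x y.
  by move: ary; rewrite -xy arx => -[<-].
have := op_ar _ _ _ _ _ _ arx ary arz; rewrite /cyc /=.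
have : x <> y :> nat by move/ord_inj/eqP; rewrite (negPf nxy).
by lia.
Qed.

Lemma even_gen_AOR a : a \in AOR n.+1 -> opres a -> even_gen a.
Proof.
move=> /AORP[/AIP[s ev aE] _] op_a; have [le_n | lt_n] := leqP n #|pdom a|.
  by rewrite aE; apply: even_gen_base; rewrite // -aE.
by rewrite -[a]pid_pdom; apply: good_opres.
Qed.

End Good.

(** * Generating sets *)

Lemma odd_permX (T : finType) (s : {perm T}) k : odd_perm (s ^+ k) = odd k && odd_perm s.
Proof.
by elim: k => [|k IHk]; rewrite ?odd_perm1 // expgS odd_permM IHk /=; case: (odd k); case: odd_perm.
Qed.

Lemma even_cycle_sqr (T : finType) (s t : {perm T}) :
  odd_perm s -> t \in <[s]> -> ~~ odd_perm t -> t \in <[s ^+ 2]>.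
Proof.
move=> odd_s /cycleP[k ->]; rewrite odd_permX odd_s andbT => even_k.
by rewrite -(odd_double_half k) (negPf even_k) -mul2n expgM mem_cycle.
Qed.

Lemma cyc_revF n (x y z : 'I_n) : cyc x y z -> cyc z y x = false.
Proof. by rewrite /cyc; lia. Qed.

Lemma liftpV n (s : 'S_n) : liftp s^-1 = (liftp s)^-1.
Proof. by rewrite /liftp lift_permV. Qed.

(** Reflecting all points and rotating one step back fixes the last point and reflects the others.
    This relation later replaces conjugation by the rotation with conjugation by the reflection. *)
Lemma refp_rotpV n : refp n.+1 * (rotp n.+1)^-1 = liftp (refp n).
Proof.
apply: (mulIg (rotp n.+1)); rewrite mulgKV; apply/permP => x; rewrite permM.
apply/ord_inj; rewrite rotpE refpE; case: (unliftP ord_max x) => [y|] ->.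
  rewrite lift_perm_lift !val_lift_max refpE modn_small; last by have := ltn_ord y; lia.
  by rewrite subSn // -ltnS.
by rewrite /liftp lift_perm_id modnn subnn.
Qed.

(** * Submonoids containing the orientation-preserving elements *)

Section Generation.
Variable m : nat.
Local Notation n := m.+1.
Local Notation N := m.+2.
Local Notation G := (rotp n).
Local Notation H := (refp n).
Implicit Types (a b : pperm N) (s u v w : 'S_N) (t : 'S_n) (i j : 'I_N) (A : {set 'I_N}).

(** Here [t] acts on all points but the last, which is omitted; [g_n] and [h_n] have this form. *)
Definition low t : pperm N := punct ord_max * pp (liftp t).

Lemma punct_fixM i s u : s i = i -> punct i * pp s * (punct i * pp u) = punct i * pp (s * u).
Proof.
move=> si; apply: pid_pp_step => x; rewrite !inE => nxi.
by apply: contraNneq nxi => sxi; apply/eqP/(@perm_inj _ s); rewrite sxi si.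
Qed.

Lemma lowM t t' : low t * low t' = low (t * t').
Proof. by rewrite /low punct_fixM ?liftp_max // liftpM. Qed.

Lemma pp_punct_pp i s u v : pp u * (punct (u i) * pp s) * pp v = punct i * pp (u * s * v).
Proof.
rewrite !ppM !mulgA pp_pid; congr (pid _ * _ * _ * _).
by apply/setP => x; rewrite !inE (inj_eq perm_inj).
Qed.

Lemma large_setT A : n <= #|A| -> A = setT \/ exists i, A = [set~ i].
Proof.
move=> leA; have [A0 | [i iA]] := set_0Vmem (~: A).
  by left; rewrite -[A]setCK A0 setC0.
right; exists i; apply/eqP; rewrite eqEcard cardsC1 card_ord leA andbT.
by apply/subsetP => x xA; rewrite !inE; apply: contraTneq xA => ->; rewrite inE in iA.
Qed.

(** One rotation brings the hole [i] of the domain to the last point, another brings the hole [s i]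
    of the image there. What remains between them fixes the last point. *)
Lemma punct_low i s : exists u t v, [/\ u \in <[G]>, v \in <[G]>,
  s = u * liftp t * v, punct i * pp s = pp u * low t * pp v &
  low t = pp u^-1 * (punct i * pp s) * pp v^-1].
Proof.
have [u u_rot ui] := rotp_transitive i ord_max.
have [v v_rot vmax] := rotp_transitive ord_max (s i).
have [|t tE] := @liftp_surj _ (u^-1 * s * v^-1).
  by rewrite !permM -{1}ui permK -vmax permK.
have sE : s = u * liftp t * v by rewrite -tE -mulgA mulgKV mulKVg.
have formE : punct i * pp s = pp u * low t * pp v.
  by rewrite sE /low -ui pp_punct_pp.
exists u, t, v; split=> //; rewrite formE; move: (low t) => c.
by rewrite !mulgA -ppM mulVg pp1 mul1g -mulgA -ppM mulgV pp1 mulg1.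
Qed.

Lemma opres_large A s : n <= #|A| -> opres (pid A * pp s) ->
  (A = setT /\ s \in <[G]>) \/
  exists u t v, [/\ u \in <[G]>, t \in <[rotp m]>, v \in <[G]>,
    s = u * liftp t * v & pid A * pp s = pp u * low t * pp v].
Proof.
move=> /large_setT[-> | [i ->]] op.
  by left; split=> //; apply: perm_opres; move: op; rewrite pidT mul1g.
right; have [u [t [v [u_rot v_rot sE formE lowE]]]] := punct_low i s.
exists u, t, v; split=> //; apply/perm_opres/opres_liftp.
rewrite -/(low t) lowE.
by apply: opresM; first apply: opresM => //; apply: opres_cycle_rotp; rewrite groupV.
Qed.

Section Closed.
Variable S : {set pperm N}.
Hypothesis S_closed : monoid_closed S.

Let S1 : 1 \in S. Proof. by case: S_closed. Qed.
Let SM a b : a \in S -> b \in S -> a * b \in S.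
Proof. by case: S_closed => _; apply. Qed.

Lemma closed_pp_cycle s u : pp s \in S -> u \in <[s]> -> pp u \in S.
Proof.
move=> Ss /cycleP[k ->]; rewrite ppX; elim: k => [|k IHk] //.
by rewrite expgS; apply: SM.
Qed.

Lemma closed_punct_cycle i s u :
  s i = i -> punct i * pp s \in S -> u \in <[s]> -> punct i * pp u \in S.
Proof.
move=> si Ss /cycleP[k ->].
have Sexp l : punct i * pp (s ^+ l.+1) \in S.
  elim: l => [|l IHl]; first by rewrite expg1.
  by rewrite expgS -punct_fixM //; apply: SM.
(* The zeroth power is [1] rather than [punct i], so the order of [s] is added to make the exponent
   positive. *)
rewrite -[s ^+ k]mul1g -(expg_order s) -expgD; have := order_gt0 s.
by case: #[s]%g => // l _; rewrite addSn; apply: Sexp.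
Qed.

Lemma closed_even_gen a :
    (forall u, u \in <[G]> -> ~~ odd_perm u -> pp u \in S) ->
    (forall u t v, u \in <[G]> -> t \in <[rotp m]> -> v \in <[G]> ->
       ~~ odd_perm (u * liftp t * v) -> pp u * low t * pp v \in S) ->
  even_gen a -> a \in S.
Proof.
move=> S_unit S_low; elim=> [|b c _ Sb _ Sc|A s leA ev op] //; first exact: SM.
have [[AT s_rot] | [u [t [v [u_rot t_rot v_rot sE ->]]]]] := opres_large leA op.
  by rewrite AT pidT mul1g; apply: S_unit.
by apply: S_low; rewrite -?sE.
Qed.

Hypothesis m_ge2 : 2 <= m.

(** For [m] odd, every rotation of the [m.+2] points is even while [rotp m] is odd. Evenness of
    [u * liftp t * v] therefore forces [t] to be a power of [rotp m ^+ 2]. *)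
Lemma closed_opres_odd a : odd m -> pp G \in S -> low (rotp m ^+ 2) \in S ->
  a \in AOR N -> opres a -> a \in S.
Proof.
move=> odd_m SG Slow aAOR op_a; have {op_a} := even_gen_AOR _ aAOR op_a.
have even_u u : u \in <[G]> -> ~~ odd_perm u.
  by case/cycleP => k ->; rewrite odd_permX odd_rotp /= odd_m andbF.
have Spp u : u \in <[G]> -> pp u \in S by apply: closed_pp_cycle.
move=> /(_ m_ge2); apply: closed_even_gen => [u /Spp // | u t v u_rot t_rot v_rot].
rewrite !odd_permM odd_liftp !(negbTE (even_u _ _)) // addbF addFb => even_t.
apply: SM; last exact: Spp.
apply: SM; first exact: Spp.
apply: (@closed_punct_cycle _ (liftp (rotp m ^+ 2))) => //; first exact: liftp_max.
have := even_cycle_sqr _ t_rot even_t; rewrite odd_rotp => /(_ odd_m)/cycleP[k ->].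
by rewrite [liftp (_ ^+ k)]liftpX mem_cycle.
Qed.

(** For [m] even, [G] is odd and [rotp m] is even, so the outer rotations [u] and [v] have equal
    parity. If both are odd, a factor [G] is shifted from each towards the centre, which is why the
    conjugates of [low t] by [G] are required. *)
Lemma closed_opres_even a : ~~ odd m -> pp (G ^+ 2) \in S -> low (rotp m) \in S ->
  (forall t, t \in <[rotp m]> -> pp G^-1 * low t * pp G \in S) ->
  a \in AOR N -> opres a -> a \in S.
Proof.
move=> even_m SG Slow SlowG aAOR op_a; have {op_a} := even_gen_AOR _ aAOR op_a.
have odd_G : odd_perm G by rewrite odd_rotp.
have Spp u : u \in <[G]> -> ~~ odd_perm u -> pp u \in S.
  by move=> u_rot ev_u; apply/(closed_pp_cycle SG)/even_cycle_sqr.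
move=> /(_ m_ge2); apply: closed_even_gen => // u t v u_rot t_rot v_rot.
have St : low t \in S.
  apply: (@closed_punct_cycle _ (liftp (rotp m))) => //; first exact: liftp_max.
  by case/cycleP: t_rot => k ->; rewrite liftpX mem_cycle.
have even_t : ~~ odd_perm t.
  by case/cycleP: t_rot => k ->; rewrite odd_permX odd_rotp (negPf even_m) andbF.
rewrite !odd_permM odd_liftp (negPf even_t) addbF => even_uv.
have [odd_u | even_u] := boolP (odd_perm u); last first.
  have even_v : ~~ odd_perm v by rewrite (negPf even_u) in even_uv.
  by apply: SM; [apply: SM => //|]; apply: Spp.
have odd_v : odd_perm v by move: even_uv; rewrite odd_u; case: odd_perm.
have -> : pp u * low t * pp v = pp (u * G) * (pp G^-1 * low t * pp G) * pp (G^-1 * v).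
  by move: (low t) => c; rewrite !mulgA -ppM mulgK -!mulgA -ppM mulKVg.
apply: SM; [apply: SM; last exact: SlowG|]; apply: Spp; rewrite ?groupM ?groupV ?cycle_id //.
  by rewrite odd_permM odd_u odd_G.
by rewrite odd_permM odd_permV odd_v odd_G.
Qed.

Lemma closed_AOR_unit w : (forall a, a \in AOR N -> opres a -> a \in S) ->
  pp w \in S -> pp w \in AOR N -> orev (pp w) -> w * w = 1 -> AOR N \subset S.
Proof.
move=> S_op Sw w_AOR rev_w ww; apply/subsetP => a a_AOR.
have /AORP[_ [op_a | rev_a]] := a_AOR; first exact: S_op.
have -> : a = a * pp w * pp w by rewrite -mulgA -ppM ww pp1 mulg1.
apply: SM => //; apply: S_op; last exact: orevM.
by case: (@AOR_closed N) => _; apply.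
Qed.

(** With every reversing permutation odd, a reversing element of [AOR] misses a point in its image.
    A rotation brings that point to the last place, and then [low t * low t], the identity off the
    last point, acts trivially on the right. *)
Lemma closed_AOR_low t : (forall a, a \in AOR N -> opres a -> a \in S) ->
    (forall s, orev (pp s) -> odd_perm s) -> (forall u, u \in <[G]> -> ~~ odd_perm u) ->
  low t \in S -> low t \in AOR N -> orev (low t) -> t * t = 1 -> AOR N \subset S.
Proof.
move=> S_op odd_rev even_G St t_AOR rev_t tt; apply/subsetP => a a_AOR.
have /AORP[/AIP[s ev_s aE] [op_a | rev_a]] := a_AOR; first exact: S_op.
have [A0 | [i iA]] := set_0Vmem (~: pdom a).
  case/negP: ev_s; apply: odd_rev.
  by move: rev_a; rewrite aE -[pdom a]setCK A0 setC0 pidT mul1g.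
have [v v_rot vs] := rotp_transitive (s i) ord_max.
have pp_AOR u : u \in <[G]> -> pp u \in AOR N.
  move=> u_rot; rewrite -[pp u]mul1g -pidT; apply: AOR_op; first exact: even_G.
  by rewrite pidT mul1g; apply: opres_cycle_rotp.
have S_pp u : u \in <[G]> -> pp u \in S.
  by move=> u_rot; apply: S_op; [apply: pp_AOR | apply: opres_cycle_rotp].
have avE : a * pp v * (low t * low t) = a * pp v.
  rewrite lowM tt /low liftp1 pp1 mulg1; apply/ppermP => x.
  rewrite mulpE; case avx: ((a * pp v) x) => [y|]; last by [].
  rewrite obind_Some punctE; case: eqP => // y_max.
  move: avx; rewrite {1}aE -mulgA -ppM pid_ppE; case: ifP => // xa [].
  rewrite permM y_max -vs => /perm_inj/perm_inj xi.
  by rewrite xi in xa; rewrite inE xa in iA.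
have -> : a = (a * pp v * low t) * low t * pp v^-1.
  by rewrite -(mulgA _ (low t) (low t)) avE -mulgA -ppM mulgV pp1 mulg1.
apply: SM; last by apply: S_pp; rewrite groupV.
apply: SM => //; apply: S_op; first exact: (AOR_mul (AOR_mul a_AOR (pp_AOR _ v_rot)) t_AOR).
by apply: orevM => //; apply: orev_opresM => //; apply: opres_cycle_rotp.
Qed.

End Closed.
End Generation.

(** * The named generators as restricted rotations and reflections *)

Lemma partial_map_Some n (P : pred nat) (F : nat -> nat) (x y : 'I_n) :
  P x -> F x = y :> nat -> partial_map P F x = Some y.
Proof. by move=> Px Fx; rewrite /partial_map Px Fx valK. Qed.

Lemma pgE n : pg n.+1 = pp (rotp n).
Proof.
by apply/ppermP => x; rewrite ffunE ppE; apply: partial_map_Some; rewrite ?rotpE.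
Qed.

Lemma phE n : ph n.+1 = pp (refp n).
Proof.
by apply/ppermP => x; rewrite ffunE ppE; apply: partial_map_Some; rewrite ?refpE.
Qed.

Lemma pgnE m : pgn m.+2 = low (rotp m).
Proof.
apply/ppermP => x; rewrite ffunE; case: (unliftP ord_max x) => [y|] ->.
  rewrite punct_liftpE; apply: partial_map_Some; rewrite val_lift_max ?ltn_ord //.
  by rewrite val_lift_max rotpE.
by rewrite /low punct_ppE eqxx /partial_map /= ltnn.
Qed.

Lemma phnE m : phn m.+2 = low (refp m).
Proof.
apply/ppermP => x; rewrite ffunE; case: (unliftP ord_max x) => [y|] ->.
  rewrite punct_liftpE; apply: partial_map_Some; rewrite val_lift_max ?ltn_ord //.
  by rewrite val_lift_max refpE.
by rewrite /low punct_ppE eqxx /partial_map /= ltnn.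
Qed.

(** The rotation carries the omitted last point to [0], the point omitted by [pg1]. *)
Lemma pg1E m : pg1 m.+2 = pp (rotp m.+1)^-1 * low (rotp m) * pp (rotp m.+1).
Proof.
rewrite /low punct_conj; apply/ppermP => x; rewrite ffunE punct_ppE.
have [z ->] : exists z, x = rotp m.+1 z by exists ((rotp m.+1)^-1 x); rewrite permKV.
rewrite (inj_eq perm_inj); case: (unliftP ord_max z) => [y|] -> {x z}.
  have rotz (w : 'I_m.+1) : rotp m.+1 (lift ord_max w) = w.+1 :> nat.
    by rewrite rotpE val_lift_max modn_small // ltnS.
  rewrite eq_sym neq_lift permJ liftp_lift; apply: partial_map_Some; rewrite !rotz //.
  rewrite rotpE eqSS; case: eqP => [-> | ny]; first by rewrite modnn.
  by rewrite modn_small // ltnS ltn_neqAle -ltnS ltn_ord andbT; apply/eqP.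
by rewrite eqxx /partial_map rotpE modnn.
Qed.

(** * The four generating sets, on [m.+2] points *)

Section Generators.
Variable m : nat.
Hypothesis m_ge2 : 2 <= m.
Local Notation N := m.+2.
Local Notation G := (rotp m.+1).
Local Notation H := (refp m.+1).
Local Notation L := (rotp m).
Local Notation K := (refp m).

Lemma pp_AOR u : ~~ odd_perm u -> opres (pp u) \/ orev (pp u) -> pp u \in AOR N.
Proof.
move=> ev; rewrite -[pp u]mul1g -pidT; case=> or_u; first exact: AOR_op.
exact: AOR_rev.
Qed.

Lemma low_AOR t : ~~ odd_perm t -> opres (pp t) \/ orev (pp t) -> low t \in AOR N.
Proof.
move=> ev or_t; have ev' : ~~ odd_perm (liftp t) by rewrite odd_liftp.
case: or_t => or_t; [apply: AOR_op | apply: AOR_rev] => //.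
  exact/opres_liftp.
exact/orev_liftp.
Qed.

Lemma rotpX_opres n k : opres (pp (rotp n ^+ k)).
Proof. exact/opres_cycle_rotp/mem_cycle. Qed.

Lemma refp_rotp_orev n : orev (pp (refp n * rotp n)).
Proof. by rewrite ppM; apply: orev_opresM; [apply: orev_refp | apply: opres_rotp]. Qed.

Lemma refp_rotp_invol n : (refp n * rotp n) * (refp n * rotp n) = 1.
Proof. by apply: rotp_reflection; rewrite mulgA refpK mul1g cycle_id. Qed.

Lemma pgn_sqr : pgn N ^+ 2 = low (L ^+ 2).
Proof. by rewrite pgnE expgS expg1 lowM. Qed.

Lemma generates_mod0 : m %% 4 = 2 ->
  generates [set pg N ^+ 2; ph N; pgn N] (AOR N).
Proof.
move=> m4; rewrite pgE phE pgnE -ppX.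
have odd_m : ~~ odd m by lia.
have even_H : ~~ odd_perm H by rewrite odd_refp; lia.
have H_AOR : pp H \in AOR N by apply: pp_AOR => //; right; apply: orev_refp.
split; first exact: AOR_closed.
  rewrite !subUset !sub1set H_AOR andbT; apply/andP; split.
    by apply: pp_AOR; [rewrite odd_permX | left; apply: rotpX_opres].
  by apply: low_AOR; [rewrite odd_rotp | left; apply: opres_rotp].
move=> S S_closed; rewrite !subUset !sub1set => /andP[/andP[S_G2 S_H] S_L].
apply: (closed_AOR_unit S_closed _ S_H H_AOR (@orev_refp _) (refpK _)) => a.
apply: closed_opres_even => // t t_rot.
(* Since [G] is [liftp K * H] and [liftp K] fixes the last point, conjugating [low t] by [G] amounts
   to conjugating [low (t ^ K)] by [H], which lies in [S]. *)
have -> : pp G^-1 * low t * pp G = pp H * low (t ^ K) * pp H.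
  have -> : G^-1 = H * liftp K by rewrite -refp_rotpV mulgA refpK mul1g.
  have -> : G = liftp K * H.
    by apply: invg_inj; rewrite invMg -liftpV !refpV -refp_rotpV mulgA refpK mul1g.
  rewrite !ppM; have -> : low (t ^ K) = pp (liftp K) * low t * pp (liftp K).
    rewrite /low -{2}[ord_max](liftp_max K) pp_punct_pp /conjg refpV -!liftpM.
    by rewrite !mulgA.
  by move: (low t) => c; rewrite !mulgA.
case: (S_closed) => _ SM; do 2?apply: (SM) => //.
apply: (@closed_punct_cycle _ _ S_closed _ (liftp L)) => //; first exact: liftp_max.
case/cycleP: t_rot => k ->; rewrite conjXg rotpJ liftpX liftpV.
by rewrite groupX // groupV cycle_id.
Qed.

Lemma generates_mod1 : m %% 4 = 3 ->
  generates [set pg N; ph N; pgn N ^+ 2] (AOR N).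
Proof.
move=> m4; rewrite pgn_sqr pgE phE.
have odd_m : odd m by lia.
have even_H : ~~ odd_perm H by rewrite odd_refp; lia.
have H_AOR : pp H \in AOR N by apply: pp_AOR => //; right; apply: orev_refp.
split; first exact: AOR_closed.
  rewrite !subUset !sub1set H_AOR andbT; apply/andP; split.
    by apply: pp_AOR; [rewrite odd_rotp /= odd_m | left; apply: opres_rotp].
  by apply: low_AOR; [rewrite odd_permX | left; apply: rotpX_opres].
move=> S S_closed; rewrite !subUset !sub1set => /andP[/andP[S_G S_H] S_L].
apply: (closed_AOR_unit S_closed _ S_H H_AOR (@orev_refp _) (refpK _)) => a.
exact: closed_opres_odd.
Qed.

(** Both [H] and [G] are odd, so [H * G] is an even reversing unit. Even units cannot move the hole
    of [pgn] to [0], of the other parity; [pg1] supplies the conjugates by [G]. *)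
Lemma generates_mod2 : m %% 4 = 0 ->
  generates [set pg N ^+ 2; ph N * pg N; pg1 N; pgn N] (AOR N).
Proof.
move=> m4; rewrite pg1E pgE phE pgnE -ppX -ppM.
have odd_m : ~~ odd m by lia.
have even_HG : ~~ odd_perm (H * G).
  by rewrite odd_permM odd_rotp odd_refp; lia.
have HG_AOR : pp (H * G) \in AOR N.
  by apply: pp_AOR => //; right; apply: refp_rotp_orev.
have jE t : pp G^-1 * low t * pp G = punct (G ord_max) * pp (liftp t ^ G).
  exact: punct_conj.
split; first exact: AOR_closed.
  rewrite !subUset !sub1set HG_AOR andbT -!andbA; apply/and3P; split.
  - by apply: pp_AOR; [rewrite odd_permX | left; apply: rotpX_opres].
  - rewrite jE; apply: AOR_op; first by rewrite odd_permJ odd_liftp odd_rotp.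
    rewrite -[pid _ * _]/(punct _ * _) -jE; apply: opres_conj; first by left; apply: cycle_id.
    exact/opres_liftp/opres_rotp.
  by apply: low_AOR; [rewrite odd_rotp | left; apply: opres_rotp].
move=> S S_closed; rewrite !subUset !sub1set => /andP[/andP[/andP[S_G2 S_HG] S_1] S_L].
apply: (closed_AOR_unit S_closed _ S_HG HG_AOR (@refp_rotp_orev _) (refp_rotp_invol _)) => a.
apply: closed_opres_even => // t t_rot; rewrite jE.
apply: (@closed_punct_cycle _ _ S_closed _ (liftp L ^ G)).
- by rewrite permJ liftp_max.
- by rewrite -jE.
by case/cycleP: t_rot => k ->; rewrite liftpX conjXg mem_cycle.
Qed.

(** Rotations of all points are even and [H] is odd, which leaves no reversing unit. As [K] and [L]
    are both odd, [low (K * L)] is an even reversing involution of rank [m.+1] to use instead. *)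
Lemma generates_mod3 : m %% 4 = 1%N ->
  generates [set pg N; pgn N ^+ 2; phn N * pgn N] (AOR N).
Proof.
move=> m4; rewrite pgn_sqr pgE phnE pgnE lowM.
have odd_m : odd m by lia.
have even_KL : ~~ odd_perm (K * L).
  by rewrite odd_permM odd_rotp odd_refp; lia.
have KL_AOR : low (K * L) \in AOR N.
  by apply: low_AOR => //; right; apply: refp_rotp_orev.
have even_G u : u \in <[G]> -> ~~ odd_perm u.
  by case/cycleP => k ->; rewrite odd_permX odd_rotp /= odd_m andbF.
split; first exact: AOR_closed.
  rewrite !subUset !sub1set KL_AOR andbT; apply/andP; split.
    by apply: pp_AOR; [apply/even_G/cycle_id | left; apply: opres_rotp].
  by apply: low_AOR; [rewrite odd_permX | left; apply: rotpX_opres].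
move=> S S_closed; rewrite !subUset !sub1set => /andP[/andP[S_G S_L2] S_KL].
apply: (closed_AOR_low S_closed _ _ even_G S_KL KL_AOR _ (refp_rotp_invol _)).
- by move=> a; apply: closed_opres_odd.
- move=> s /perm_orev/even_G; rewrite odd_permM odd_refp (_ : odd _ = true) //.
    by case: odd_perm.
  by lia.
exact/orev_liftp/refp_rotp_orev.
Qed.

End Generators.

(** * Lower bounds *)

Section Units.
Variable n : nat.
Implicit Types (a b : pperm n) (s t : 'S_n) (B M S : {set pperm n}).

Definition units : {set pperm n} := [set a : pperm n | pdom a == setT].

Lemma pp_inj : injective (@pp n).
Proof.
by move=> s t eq_st; apply/permP => x; have := ppE s x; rewrite eq_st ppE => -[].
Qed.

Lemma unitsP a : reflect (exists s, a = pp s) (a \in units).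
Proof.
rewrite inE; apply: (iffP eqP) => [aT | [s ->]]; last exact: pdom_pp.
have aE x : a x = Some (odflt x (a x)).
  by have := in_setT x; rewrite -aT inE; case: (a x).
have inj_a : injective (fun x => odflt x (a x)).
  by move=> x y eq_xy; apply: (pperm_inj (aE x)); rewrite aE eq_xy.
by exists (perm inj_a); apply/ppermP => x; rewrite ppE permE -aE.
Qed.

Lemma units_mul a b : (a * b \in units) = (a \in units) && (b \in units).
Proof.
apply/idP/andP => [abU | [/unitsP[s ->] /unitsP[t ->]]]; last first.
  by rewrite -ppM; apply/unitsP; exists (s * t).
have aU : a \in units.
  move: abU; rewrite /units !in_set => /eqP abT.
  by rewrite eqEsubset subsetT -abT pdom_mul.
split=> //; case/unitsP: aU abU => s ->; rewrite /units !in_set => /eqP sbT.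
apply/eqP/setP => x; rewrite [RHS]inE inE.
have : s^-1 x \in pdom (pp s * b) by rewrite sbT inE.
by rewrite inE mulpE ppE obind_Some permKV.
Qed.

Lemma units_closed : monoid_closed units.
Proof.
split=> [|a b aU bU]; last by rewrite units_mul aU.
by apply/unitsP; exists 1; rewrite pp1.
Qed.

(** A product is a unit only if both factors are. This submonoid contains everything that nonunits
    and one unit [pp s] can generate. *)
Lemma cycle_or_nonunit_closed s :
  monoid_closed (~: units :|: [set pp u | u in <[s]>]).
Proof.
split=> [|a b].
  by apply/setUP; right; apply/imsetP; exists 1; rewrite ?pp1 // group1.
rewrite !in_setU !in_setC units_mul negb_and => aS bS.
case: (boolP (a \in units)) aS => //= _ /imsetP[u u_s ->].
case: (boolP (b \in units)) bS => //= _ /imsetP[v v_s ->].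
by apply/imsetP; exists (u * v); rewrite ?groupM // ppM.
Qed.

Lemma generates_sub B M S : generates B M -> monoid_closed S -> B \subset S -> M \subset S.
Proof. by case=> _ _; apply. Qed.

Lemma two_units B M s t : generates B M -> pp s \in M -> pp t \in M ->
  (forall u, pp u \in M -> s \in <[u]> -> t \in <[u]> -> False) -> 1 < #|B :&: units|.
Proof.
move=> genB Ms Mt no_cycle; rewrite ltnNge; apply/negP => /card_le1_eqP B_le1.
have [M_closed BM _] := genB.
(* If [B] contains no unit, [u] is taken to be [1]. *)
have [u Mu BU] : exists2 u, pp u \in M & {in B :&: units, forall a, a = pp u}.
  have [B0 | [a aB]] := set_0Vmem (B :&: units).
    by exists 1 => [|a]; [rewrite pp1; case: M_closed | rewrite B0 inE].
  have /setIP[/(subsetP BM) aM /unitsP[u aE]] := aB.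
  by exists u => [|b bB]; rewrite -aE //; apply: B_le1.
have MS : M \subset ~: units :|: [set pp u | u in <[u]>].
  apply: (generates_sub genB); first exact: cycle_or_nonunit_closed.
  apply/subsetP => a aB; rewrite in_setU in_setC.
  have [aU | //] := boolP (a \in units); apply/imsetP; exists u; first exact: cycle_id.
  by apply: BU; rewrite inE aB.
have in_cycle r : pp r \in M -> r \in <[u]>.
  move/(subsetP MS); rewrite in_setU in_setC; have -> : pp r \in units by apply/unitsP; exists r.
  by case/imsetP => r' r'u /pp_inj->.
by apply: (no_cycle u) => //; apply: in_cycle.
Qed.

Lemma one_unit B M s : generates B M -> pp s \in M -> s != 1 -> 0 < #|B :&: units|.
Proof.
move=> genB Ms s_ne1; rewrite lt0n cards_eq0; apply/eqP => B0.
have : M \subset ~: units :|: [set pp u | u in <[1%g : 'S_n]>].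
  apply: (generates_sub genB); first exact: cycle_or_nonunit_closed.
  apply/subsetP => a aB; rewrite in_setU in_setC.
  have [aU | //] := boolP (a \in units).
  by have : a \in B :&: units; [rewrite inE aB | rewrite B0 inE].
move/subsetP/(_ _ Ms); rewrite in_setU in_setC.
have -> : pp s \in units by apply/unitsP; exists s.
by case/imsetP => r; rewrite cycle1 => /set1P-> /pp_inj/eqP; apply/negP.
Qed.

Lemma one_nonunit B M a : generates B M -> a \in M -> a \notin units -> 0 < #|B :\: units|.
Proof.
move=> genB aM; apply: contraR; rewrite lt0n negbK cards_eq0 setD_eq0 => BU.
exact: subsetP (generates_sub genB units_closed BU) _ aM.
Qed.

End Units.

(** The first three points of the domain form a cyclic triple whose image would be cyclic in both
    directions. *)
Lemma opres_orevF n (a : pperm n) : 2 < #|pdom a| -> opres a -> orev a -> False.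
Proof.
move=> gt2 op rev; pose d := enum (pdom a); have gt2' : 2 < size d by rewrite -cardE.
case: n a gt2 op rev @d gt2' => [|n] a gt2 op rev d gt2'; first by case: d gt2' => [|[]].
have lt_d i j : i < j -> j < size d -> nth ord0 d i < nth ord0 d j.
  move=> ltij ltj; apply: (sorted_ltn_nth _ ord0 (sorted_enum_ord _)) => //.
  - by move=> y x z /= /ltn_trans; apply.
  - by rewrite inE; apply: ltn_trans ltj.
have inD i : i < size d -> exists y, a (nth ord0 d i) = Some y.
  by move=> lti; apply/pdomP; rewrite -mem_enum mem_nth.
have lt1 : 1 < size d by apply: ltn_trans gt2'.
have [x ax] := inD 0 (ltn_trans (ltnSn 0) lt1); have [y ay] := inD 1%N lt1.
have [z az] := inD 2 gt2'.
have cyc012 : cyc (nth ord0 d 0) (nth ord0 d 1) (nth ord0 d 2).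
  by rewrite /cyc (lt_d 0 1%N) ?(lt_d 1%N 2).
by have := op _ _ _ _ _ _ ax ay az cyc012; rewrite (cyc_revF (rev _ _ _ _ _ _ ax ay az cyc012)).
Qed.

(** * Lower bounds by residue class *)

Section LowerBound.
Variable m : nat.
Hypothesis m_ge2 : 2 <= m.
Local Notation N := m.+2.
Local Notation G := (rotp m.+1).
Local Notation H := (refp m.+1).
Local Notation L := (rotp m).
Local Notation K := (refp m).
Implicit Types (a b v : pperm N) (s u w : 'S_N) (t : 'S_m.+1) (B S : {set pperm N}).

Lemma pp_orevF s : opres (pp s) -> orev (pp s) -> False.
Proof. by apply: opres_orevF; rewrite pdom_pp cardsT card_ord; lia. Qed.

Lemma pdom_punct_pp (i : 'I_N) s : pdom (punct i * pp s) = [set~ i].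
Proof. exact: pdom_pid_pp. Qed.

Lemma punct_pp_nonunit (i : 'I_N) s : punct i * pp s \notin units N.
Proof.
rewrite inE pdom_punct_pp; apply/eqP => /setP/(_ i).
by rewrite !inE eqxx.
Qed.

Lemma pdom_low t : pdom (low t) = [set~ ord_max].
Proof. exact: pdom_punct_pp. Qed.

Lemma low_nonunit t : low t \notin units N.
Proof. exact: punct_pp_nonunit. Qed.

Lemma low_orevF t : opres (low t) -> orev (low t) -> False.
Proof. by apply: opres_orevF; rewrite pdom_low cardsC1 card_ord; lia. Qed.

Lemma AOR_pp u : pp u \in AOR N -> ~~ odd_perm u /\ (opres (pp u) \/ orev (pp u)).
Proof.
move=> /AORP[/AIP[s ev]]; rewrite pdom_pp pidT mul1g => /pp_inj-> //.
Qed.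

Lemma orev_invol n (s : 'S_n.+1) : orev (pp s) -> s * s = 1.
Proof. by move=> /perm_orev/rotp_reflection. Qed.

Lemma invol_cycle n (t r : 'S_n) : t * t = 1 -> r \in <[t]> -> r = 1 \/ r = t.
Proof.
move=> tt /cycleP[k ->]; rewrite -(odd_double_half k) expgD -mul2n expgM.
by rewrite expgS expg1 tt expg1n mulg1; case: (odd k); [right | left].
Qed.

(** No single unit [u] has both [s] and [w] among its powers: powers of a preserving [u] are
    preserving, and a reversing [u] is an involution, whose only nontrivial power is reversing. *)
Lemma two_units_AOR B s w : generates B (AOR N) -> pp s \in AOR N -> pp w \in AOR N ->
  opres (pp s) -> s != 1 -> orev (pp w) -> 1 < #|B :&: units N|.
Proof.
move=> genB s_AOR w_AOR op_s s_ne1 rev_w.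
apply: (two_units genB s_AOR w_AOR) => u /AOR_pp[_ [op_u | rev_u]] s_u w_u.
  apply: pp_orevF rev_w; apply: opres_cycle_rotp.
  by apply: (subsetP _ _ w_u); rewrite cycle_subG; apply: perm_opres.
have [s1 | su] := invol_cycle (orev_invol rev_u) s_u; first by rewrite s1 eqxx in s_ne1.
by apply: pp_orevF rev_u; rewrite -su.
Qed.

Lemma rotpX_ne1 n k : 0 < k < n.+1 -> rotp n ^+ k != 1.
Proof.
move=> /andP[k_gt0 ltk]; apply/eqP => /permP/(_ ord0)/(congr1 (@nat_of_ord _)).
by rewrite rotpXE perm1 /= add0n modn_small //; lia.
Qed.

(** With an even number of points, [G] and [H] both switch the parity of points, and here both are
    odd permutations. An even product of them hence preserves the parity of points. *)
Lemma AOR_unit_parity u (x : 'I_N) : m %% 4 = 0 -> pp u \in AOR N -> odd (u x) = odd x.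
Proof.
move=> m4 /AOR_pp[ev or_u].
have oddG k (y : 'I_N) : odd ((G ^+ k) y) = odd y (+) odd k.
  by rewrite rotpXE odd_mod ?oddD //=; lia.
have odd_G : odd_perm G by rewrite odd_rotp; lia.
case: or_u => [/perm_opres/cycleP[k uE] | /perm_orev/cycleP[k uE]].
  by move: ev; rewrite uE odd_permX odd_G andbT oddG => /negPf->; rewrite addbF.
have {}uE : u = H * G ^+ k by rewrite -uE mulgA refpK mul1g.
move: ev; rewrite uE odd_permM odd_permX odd_G andbT odd_refp permM oddG refpE.
by have := ltn_ord x; lia.
Qed.

(** A nonunit first factor keeps its hole in the product. A unit first factor moves the hole of the
    second by its inverse, which preserves parity. *)
Lemma parity_closed (p : bool) : m %% 4 = 0 ->
  monoid_closed [set a in AOR N | (a \in units N) || [exists x, (x \notin pdom a) && (odd x == p)]].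
Proof.
move=> m4; split=> [|a b].
  by apply/setIdP; split; [case: (@AOR_closed N) | case: (units_closed N) => ->].
move=> /setIdP[aAOR a_p] /setIdP[bAOR b_p]; apply/setIdP; split; first exact: AOR_mul.
have [/existsP[x /andP[xa xp]] | a_full] :=
    boolP [exists x, (x \notin pdom a) && (odd x == p)].
  apply/orP; right; apply/existsP; exists x; rewrite xp andbT.
  by apply: contra xa; apply: (subsetP (pdom_mul a b)).
have aU : a \in units N by rewrite (negPf a_full) orbF in a_p.
rewrite units_mul aU; have [// | b_nU] := boolP (b \in units N).
have /existsP[x /andP[xb xp]] : [exists x, (x \notin pdom b) && (odd x == p)].
  by rewrite (negPf b_nU) in b_p.
have /unitsP[u aE] := aU; apply/existsP; exists (u^-1 x).
rewrite -(@AOR_unit_parity u) // -?aE // permKV xp andbT.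
apply: contra xb => /pdomP[y]; rewrite aE mulpE ppE obind_Some permKV => bxy.
by apply/pdomP; exists y.
Qed.

Lemma two_nonunits_mod2 B : m %% 4 = 0 -> generates B (AOR N) -> 1 < #|B :\: units N|.
Proof.
move=> m4 genB; have [_ BAOR _] := genB.
have even_L : ~~ odd_perm L by rewrite odd_rotp; lia.
have [_ /subsetP gens _] := generates_mod2 m_ge2 m4.
have pgn_AOR : pgn N \in AOR N by apply: gens; rewrite !inE eqxx !orbT.
have pg1_AOR : pg1 N \in AOR N by apply: gens; rewrite !inE eqxx !orbT.
rewrite ltnNge; apply/negP => /card_le1_eqP B_le1.
have [p Bp] : exists p, B \subset
    [set a in AOR N | (a \in units N) || [exists x, (x \notin pdom a) && (odd x == p)]].
  have [B0 | [v vB]] := set_0Vmem (B :\: units N).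
    exists true; apply/subsetP => a aB; apply/setIdP; split; first exact: (subsetP BAOR).
    apply/orP; left; apply: contraT => aU.
    by have := in_set0 a; rewrite -B0 in_setD aU aB.
  have [x xv] : exists x, x \notin pdom v.
    apply/existsP; case/setDP: vB => _; apply: contraR => /existsPn all_v.
    rewrite inE; apply/eqP/setP => x; rewrite [RHS]inE; exact/negPn/all_v.
  exists (odd x); apply/subsetP => a aB; apply/setIdP; split; first exact: (subsetP BAOR).
  have [// | a_nU] := boolP (a \in units N); apply/existsP; exists x.
  have -> : a = v by apply: B_le1; rewrite // in_setD aB a_nU.
  by rewrite xv eqxx.
(* The hole of [pgn] is the last point, of odd value [m.+1], and that of [pg1] is [0]; no [p] fits
   both. *)
have /subsetP AOR_p := generates_sub genB (parity_closed p m4) Bp.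
have [] := (setIdP (AOR_p _ pgn_AOR)); rewrite pgnE (negPf (low_nonunit _)) pdom_low => _.
case/existsP => x; rewrite !inE negbK => /andP[/eqP-> /eqP p_odd].
have [] := (setIdP (AOR_p _ pg1_AOR)).
rewrite pg1E /low punct_conj (negPf (punct_pp_nonunit _ _)) pdom_punct_pp => _.
case/existsP => y; rewrite !inE negbK -p_odd => /andP[/eqP-> /eqP].
by rewrite rotpE modnn /=; lia.
Qed.

Lemma card_pdom_mul a b : #|pdom (a * b)| <= #|pdom a| /\ #|pdom (a * b)| <= #|pdom b|.
Proof.
split; first exact/subset_leq_card/pdom_mul.
rewrite -(@card_in_imset _ _ (fun x => odflt x (a x))) => [|x y].
  apply/subset_leq_card/subsetP => _ /imsetP[x /pdomP[z /mulp_Some[y -> yz]] ->].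
  by apply/pdomP; exists z.
move=> /pdomP[z /mulp_Some[u ax _]] /pdomP[z' /mulp_Some[v ay _]].
by rewrite ax ay /= => uv; apply: pperm_inj ax _; rewrite ay uv.
Qed.

(** This ideal collects the products that have lost a second point, irrelevant to elements of rank
    at least [m.+1]. *)
Definition thin : {set pperm N} := [set a : pperm N | #|pdom a| < m.+1].

Lemma thin_mull a b : a \in thin -> a * b \in thin.
Proof. by rewrite !inE; apply: leq_ltn_trans; case: (card_pdom_mul a b). Qed.

Lemma thin_mulr a b : b \in thin -> a * b \in thin.
Proof. by rewrite !inE; apply: leq_ltn_trans; case: (card_pdom_mul a b). Qed.

Lemma pdom_pp_mul u w a x : (x \in pdom (pp u * a * pp w)) = (u x \in pdom a).
Proof.
rewrite !inE mulpE mulpE ppE obind_Some; case: (a (u x)) => // y.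
by rewrite obind_Some ppE.
Qed.

(** Besides the last point, the product loses the point that the first two factors send to the last
    one. *)
Lemma low_pp_low_thin (r r' : 'S_m.+1) w : w ord_max != ord_max -> low r * pp w * low r' \in thin.
Proof.
move=> w_max; rewrite inE.
have card_max : #|[set~ (@ord_max m.+1)]| = m.+1 by rewrite cardsC1 card_ord.
apply: leq_trans (proper_card _) (eq_leq card_max); apply/properP; split.
  by rewrite -(pdom_low r) -mulgA pdom_mul.
pose x := (liftp r * w)^-1 ord_max; exists x.
  rewrite !inE; apply: contra w_max => /eqP xmax.
  have : (liftp r * w) x = ord_max by rewrite permKV.
  by rewrite xmax permM liftp_max => ->.
rewrite inE mulpE /low -mulgA -ppM punct_ppE; case: eqP => // _.
by rewrite obind_Some /x permKV punct_ppE eqxx.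
Qed.

(* For an involution [t], these are the elements of rank [n - 1] in the monoid
   generated by the rotations and any one [pp u * low t * pp w]. *)
Definition sandwich t : {set pperm N} :=
  [set a | [exists u in <[G]>, exists r in <[t]>, exists w in <[G]>,
    a == pp u * low r * pp w]].

Lemma sandwichP t a : reflect
  (exists u r w, [/\ u \in <[G]>, r \in <[t]>, w \in <[G]> & a = pp u * low r * pp w])
  (a \in sandwich t).
Proof.
rewrite inE; apply: (iffP exists_inP) => [[u uG /exists_inP[r rt /exists_inP[w wG /eqP aE]]]|].
  by exists u, r, w.
case=> u [r [w [uG rt wG ->]]]; exists u => //; apply/exists_inP; exists r => //.
by apply/exists_inP; exists w.
Qed.

Lemma rotp_fix u x : u \in <[G]> -> u x = x -> u = 1.
Proof.
case/cycleP => k -> /(congr1 (@nat_of_ord _)); rewrite rotpXE => ux.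
apply/permP => y; rewrite perm1; apply/ord_inj; rewrite rotpXE.
have : x + k = x + 0 %[mod N] by rewrite addn0 ux modn_small.
by move/eqP; rewrite eqn_modDl mod0n => /eqP k0; rewrite -modnDmr k0 addn0 modn_small.
Qed.

(** When two sandwiches meet, the rotation between them either is trivial, and the inner maps
    multiply, or moves the last point, and the rank drops. *)
Lemma sandwich_closed t :
  monoid_closed (thin :|: [set pp u | u in <[G]>] :|: sandwich t).
Proof.
have ppP u : u \in <[G]> -> pp u \in [set pp u | u in <[G]>] by move=> uG; apply: imset_f.
split=> [|a b].
  by rewrite 2!in_setU -pp1 ppP ?orbT // group1.
rewrite !(in_setU, in_setU) => /orP[/orP[a_thin _ | /imsetP[u uG ->]] | a_s].
- by rewrite thin_mull.
- case/orP => [/orP[b_thin | /imsetP[w wG ->]] | /sandwichP[u' [r [w [u'G rt wG ->]]]]].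
  + by rewrite thin_mulr.
  + by rewrite -ppM ppP ?orbT // groupM.
  apply/orP; right; apply/sandwichP; exists (u * u'), r, w.
  by rewrite groupM //; split=> //; rewrite ppM !mulgA.
have /sandwichP[u [r [w [uG rt wG ->]]]] := a_s.
case/orP => [/orP[b_thin | /imsetP[w' w'G ->]] | /sandwichP[u' [r' [w' [u'G r't w'G ->]]]]].
- by rewrite thin_mulr.
- apply/orP; right; apply/sandwichP; exists u, r, (w * w').
  by rewrite groupM //; split=> //; rewrite ppM !mulgA.
have -> : pp u * low r * pp w * (pp u' * low r' * pp w') =
    pp u * (low r * pp (w * u') * low r') * pp w'.
  by move: (low r) (low r') => c c'; rewrite ppM !mulgA.
have [wu_max | wu_max] := eqVneq ((w * u') ord_max) ord_max; last first.
  by rewrite thin_mull // thin_mulr // low_pp_low_thin.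
have wu1 : w * u' = 1 by apply: rotp_fix wu_max; rewrite groupM.
apply/orP; right; apply/sandwichP; exists u, (r * r'), w'; rewrite groupM //.
by split=> //; rewrite wu1 pp1 mulg1 lowM.
Qed.

Lemma two_nonunits_mod3 B : m %% 4 = 1%N -> generates B (AOR N) -> 1 < #|B :\: units N|.
Proof.
move=> m4 genB; have [_ BAOR _] := genB.
have m_ge5 : 5 <= m by lia.
have even_G u : pp u \in AOR N -> u \in <[G]>.
  move=> /AOR_pp[ev [/perm_opres // | /perm_orev/cycleP[k Hu]]].
  have : odd_perm (H * u) by rewrite odd_permM odd_refp (negPf ev); lia.
  by rewrite Hu odd_permX odd_rotp; lia.
have [_ /subsetP gens _] := generates_mod3 m_ge2 m4.
have L2_AOR : low (L ^+ 2) \in AOR N.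
  by rewrite -pgn_sqr; apply: gens; rewrite !inE eqxx !orbT.
have KL_AOR : low (K * L) \in AOR N.
  by rewrite -lowM -phnE -pgnE; apply: gens; rewrite !inE eqxx !orbT.
have op_L2 : opres (low (L ^+ 2)) by apply/opres_liftp/rotpX_opres.
have rev_KL : orev (low (K * L)) by apply/orev_liftp/refp_rotp_orev.
have not_thin t : low t \notin thin by rewrite inE pdom_low cardsC1 card_ord ltnn.
have not_pp t : low t \notin [set pp u | u in <[G]>].
  apply/imsetP => -[u _ tu]; have := low_nonunit t; rewrite tu.
  by case/unitsP; exists u.
rewrite ltnNge; apply/negP => /card_le1_eqP B_le1.
have unit_B t : {in B :\: units N, forall a, a \in thin :|: sandwich t} ->
    AOR N \subset thin :|: [set pp u | u in <[G]>] :|: sandwich t.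
  move=> nonunit_B; apply: (generates_sub genB (sandwich_closed t)).
  apply/subsetP => a aB; have [/unitsP[u aE] | a_nU] := boolP (a \in units N).
    rewrite 2!in_setU aE; apply/orP; left; apply/orP; right.
    by apply/imset_f/even_G; rewrite -aE (subsetP BAOR).
  have : a \in thin :|: sandwich t by apply: nonunit_B; rewrite in_setD a_nU.
  by rewrite !in_setU => /orP[] ->; rewrite ?orbT.
have sandwich_false t : t * t = 1 -> orev (pp t) \/ t = 1 ->
    {in B :\: units N, forall a, a \in thin :|: sandwich t} -> False.
  move=> tt rev_t /unit_B/subsetP/(_ _ L2_AOR); rewrite 2!in_setU.
  rewrite (negPf (not_thin _)) (negPf (not_pp _)) => /sandwichP[u [r [w [uG rt wG L2E]]]].
  have [r1 | rE] : r = 1 \/ r = t /\ orev (pp t).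
    have [-> | ->] := invol_cycle tt rt; first by left.
    by case: rev_t => [|->]; [right | left].
  (* Here [low r] is a partial identity, so [low (L ^+ 2)] would be a restriction of a rotation;
     comparing domains removes [u]. *)
  - have u1 : u = 1.
      apply: (@rotp_fix _ ord_max) => //; have := pdom_pp_mul u w (low r) ord_max.
      by rewrite -L2E !pdom_low !inE eqxx /= => /esym/negbFE/eqP.
    have Lw (x : 'I_m.+1) : lift ord_max ((L ^+ 2) x) = w (lift ord_max x).
      have := punct_liftpE (L ^+ 2) x; rewrite -/(low _) L2E u1 r1 pp1 mul1g.
      by rewrite /low liftp1 pp1 mulg1 punct_ppE eq_sym neq_lift => -[].
    (* The image of [0] forces [k] to be [2] modulo [N]. The rotation then sends the point [m] to
       [0], whereas [L ^+ 2] sends it to [1]. *)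
    case/cycleP: wG Lw => k -> Lk.
    have := congr1 (@nat_of_ord _) (Lk ord0); have := congr1 (@nat_of_ord _) (Lk ord_max).
    rewrite !val_lift_max !rotpXE !val_lift_max /= !add0n => Lmax L0.
    have kE : k %% N = 2 by rewrite -L0 modn_small //; lia.
    have mE : (m + 2) %% m.+1 = 1%N.
      by rewrite (_ : m + 2 = m.+1 + 1)%N ?modnDl ?modn_small //; lia.
    by move: Lmax; rewrite mE -modnDmr kE addn2 modnn.
  - case: rE => rE {}rev_t; apply: low_orevF op_L2 _; rewrite L2E.
    apply: orev_opresM; last exact: opres_cycle_rotp.
    apply: opres_orevM; first exact: opres_cycle_rotp.
    by rewrite rE; apply/orev_liftp.
(* A single nonunit [v] is absent, thin, preserving, or reversing of rank [m.+1]. The first two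
   cases are covered by the sandwich of [1], the last by that of a reversing involution. *)
have [B0 | [v vB]] := set_0Vmem (B :\: units N).
  apply: (sandwich_false 1) => [||a]; [exact: mulg1 | by right | by rewrite B0 inE].
have B_v a : a \in B :\: units N -> a = v by move=> aB; apply: B_le1.
have [vU vB'] := setDP vB; have v_AOR := subsetP BAOR _ vU.
have [v_thin | v_nthin] := boolP (v \in thin).
  apply: (sandwich_false 1) => [||a /B_v->]; [exact: mulg1 | by right |].
  by rewrite in_setU v_thin.
have /AORP[/AIP[s ev_s vE] [op_v | rev_v]] := v_AOR.
  (* If [v] is preserving, so are all generators, the units being rotations; but [low (K * L)] is
     reversing. *)
  have AOR_op : AOR N \subset [set a | orientation_preserving a].
    apply: (generates_sub genB).
      split=> [|a b]; first by rewrite inE; apply/orientation_preservingP/opres1.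
      rewrite !inE => /orientation_preservingP opa /orientation_preservingP opb.
      exact/orientation_preservingP/opresM.
    apply/subsetP => a aB; rewrite inE; apply/orientation_preservingP.
    have [/unitsP[u aE] | a_nU] := boolP (a \in units N).
      by rewrite aE; apply/opres_cycle_rotp/even_G; rewrite -aE (subsetP BAOR).
    by rewrite (B_v a) // in_setD a_nU.
  have := subsetP AOR_op _ KL_AOR; rewrite inE => /orientation_preservingP op_KL.
  exact: low_orevF op_KL rev_KL.
have [vT | [i vi]] : pdom v = setT \/ exists i, pdom v = [set~ i].
- by apply: large_setT; rewrite inE -leqNgt in v_nthin.
- by case/negP: vB'; rewrite inE vT.
have [u [t [w [uG wG _ formE lowE]]]] := punct_low i s.
have vE' : v = punct i * pp s by rewrite vE vi.
have rev_t : orev (pp t).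
  apply/orev_liftp; rewrite -/(low t) lowE -vE'.
  apply: orev_opresM; last by apply: opres_cycle_rotp; rewrite groupV.
  by apply: opres_orevM => //; apply: opres_cycle_rotp; rewrite groupV.
apply: (sandwich_false t) => [||a /B_v->]; [exact: orev_invol | by left |].
apply/setUP; right; apply/sandwichP; exists u, t, w; split=> //; first exact: cycle_id.
by rewrite vE'.
Qed.

Lemma rank_mod0 B : m %% 4 = 2 -> generates B (AOR N) -> 3 <= #|B|.
Proof.
move=> m4 genB; rewrite -(cardsID (units N) B).
have [_ /subsetP gens _] := generates_mod0 m_ge2 m4.
have G2_AOR : pp (G ^+ 2) \in AOR N by apply: gens; rewrite ppX pgE !inE eqxx.
have H_AOR : pp H \in AOR N by apply: gens; rewrite phE !inE eqxx orbT.
have L_AOR : low L \in AOR N by apply: gens; rewrite pgnE !inE eqxx orbT.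
have G2_ne1 : G ^+ 2 != 1 by apply: rotpX_ne1; lia.
have := two_units_AOR genB G2_AOR H_AOR (@rotpX_opres _ _) G2_ne1 (@orev_refp _).
by have := one_nonunit genB L_AOR (low_nonunit _); lia.
Qed.

Lemma rank_mod1 B : m %% 4 = 3 -> generates B (AOR N) -> 3 <= #|B|.
Proof.
move=> m4 genB; rewrite -(cardsID (units N) B).
have [_ /subsetP gens _] := generates_mod1 m_ge2 m4.
have G_AOR : pp G \in AOR N by apply: gens; rewrite pgE !inE eqxx.
have H_AOR : pp H \in AOR N by apply: gens; rewrite phE !inE eqxx orbT.
have L2_AOR : low (L ^+ 2) \in AOR N by apply: gens; rewrite pgn_sqr !inE eqxx orbT.
have G_ne1 : G != 1 by apply: (@rotpX_ne1 _ 1); lia.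
have := two_units_AOR genB G_AOR H_AOR (@opres_rotp _) G_ne1 (@orev_refp _).
by have := one_nonunit genB L2_AOR (low_nonunit _); lia.
Qed.

Lemma rank_mod2 B : m %% 4 = 0 -> generates B (AOR N) -> 4 <= #|B|.
Proof.
move=> m4 genB; rewrite -(cardsID (units N) B).
have [_ /subsetP gens _] := generates_mod2 m_ge2 m4.
have G2_AOR : pp (G ^+ 2) \in AOR N by apply: gens; rewrite ppX pgE !inE eqxx.
have HG_AOR : pp (H * G) \in AOR N.
  by apply: gens; rewrite ppM pgE phE !inE eqxx !orbT.
have G2_ne1 : G ^+ 2 != 1 by apply: rotpX_ne1; lia.
have := two_units_AOR genB G2_AOR HG_AOR (@rotpX_opres _ _) G2_ne1 (@refp_rotp_orev _).
by have := two_nonunits_mod2 m4 genB; lia.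
Qed.

Lemma rank_mod3 B : m %% 4 = 1%N -> generates B (AOR N) -> 3 <= #|B|.
Proof.
move=> m4 genB; rewrite -(cardsID (units N) B).
have [_ /subsetP gens _] := generates_mod3 m_ge2 m4.
have G_AOR : pp G \in AOR N by apply: gens; rewrite pgE !inE eqxx.
have G_ne1 : G != 1 by apply: (@rotpX_ne1 _ 1); lia.
by have := one_unit genB G_AOR G_ne1; have := two_nonunits_mod3 m4 genB; lia.
Qed.

End LowerBound.

(** An upper bound on the size of [A] suffices: the lower bound applied to [A] itself shows that the
    listed generators are distinct. *)
Lemma min_generating n (A M : {set pperm n}) k : generates A M -> #|A| <= k ->
    (forall B, generates B M -> k <= #|B|) ->
  min_generating_set A M /\ #|A| = k.
Proof.
move=> genA leA geB; split; last by apply/eqP; rewrite eqn_leq leA geB.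
by split=> // B /geB; apply: leq_trans.
Qed.

Lemma card_setU1_le (T : finType) (A : {set T}) x k : #|A| <= k -> #|A :|: [set x]| <= k.+1.
Proof. by move=> leA; rewrite setUC cardsU1 -add1n leq_add ?leq_b1. Qed.

Theorem theorem5p1 (n : nat) (hn : 4 <= n) :
  [/\ n = 0 %[mod 4] -> min_generating_set [set pg n ^+ 2; ph n; pgn n] (AOR n),
      n = 1 %[mod 4] -> min_generating_set [set pg n; ph n; pgn n ^+ 2] (AOR n),
      n = 2 %[mod 4] ->
        min_generating_set [set pg n ^+ 2; ph n * pg n; pg1 n; pgn n] (AOR n) &
      n = 3 %[mod 4] ->
        min_generating_set [set pg n; pgn n ^+ 2; phn n * pgn n] (AOR n)] /\
  (n = 2 %[mod 4] -> has_rank (AOR n) 4) /\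
  (n <> 2 %[mod 4] -> has_rank (AOR n) 3).
Proof.
(* Writing [n] as [m.+2] shifts the residues: [n] congruent to 0, 1, 2, 3 corresponds to [m]
   congruent to 2, 3, 0, 1. *)
case: n hn => [|[|m]] // m_ge2.
have min0 (m4 : m %% 4 = 2) : min_generating_set _ _ /\ _ :=
  min_generating (generates_mod0 m_ge2 m4)
    (card_setU1_le _ (card_setU1_le _ (eq_leq (cards1 _)))) (fun B => rank_mod0 m_ge2 m4).
have min1 (m4 : m %% 4 = 3) : min_generating_set _ _ /\ _ :=
  min_generating (generates_mod1 m_ge2 m4)
    (card_setU1_le _ (card_setU1_le _ (eq_leq (cards1 _)))) (fun B => rank_mod1 m_ge2 m4).
have min2 (m4 : m %% 4 = 0) : min_generating_set _ _ /\ _ :=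
  min_generating (generates_mod2 m_ge2 m4)
    (card_setU1_le _ (card_setU1_le _ (card_setU1_le _ (eq_leq (cards1 _)))))
    (fun B => rank_mod2 m_ge2 m4).
have min3 (m4 : m %% 4 = 1%N) : min_generating_set _ _ /\ _ :=
  min_generating (generates_mod3 m_ge2 m4)
    (card_setU1_le _ (card_setU1_le _ (eq_leq (cards1 _)))) (fun B => rank_mod3 m_ge2 m4).
split; [split=> n4|split=> n4].
- by case: min0 => //; lia.
- by case: min1 => //; lia.
- by case: min2 => //; lia.
- by case: min3 => //; lia.
- have [|minA cardA] := min2; first by lia.
  by exists [set pg m.+2 ^+ 2; ph m.+2 * pg m.+2; pg1 m.+2; pgn m.+2].
have [m4 | [m4 | m4]] : m %% 4 = 2 \/ m %% 4 = 3 \/ m %% 4 = 1%N by lia.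
- by have [minA cardA] := min0 m4; exists [set pg m.+2 ^+ 2; ph m.+2; pgn m.+2].
- by have [minA cardA] := min1 m4; exists [set pg m.+2; ph m.+2; pgn m.+2 ^+ 2].
by have [minA cardA] := min3 m4; exists [set pg m.+2; pgn m.+2 ^+ 2; phn m.+2 * pgn m.+2].
Qed.
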